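(* Suppose $G=(V,E)$ is a tree graph with $V=\{1,\dots,n\}$ and root node $1$, the collection $\{x_v^\star\}_{v\in V}\subset\mathbb{R}^d$ is $(G,s,s')$-sparse, $A_v=\frac{1}{\sqrt{N_{\text{Non-root}}}}A_{\text{Non-root}}$ for all $v\ne1$, with one common matrix $A_{\text{Non-root}}\in\mathbb{R}^{N_{\text{Non-root}}\times d}$, and $A_1=\frac{1}{\sqrt{N_1}}A_{\text{Root}}$ with $A_{\text{Root}}\in\mathbb{R}^{N_1\times d}$, where $N_{\text{Root}}=N_1$. Assume that $A_{\text{Root}}$ and $A_{\text{Non-root}}$ each have i.i.d. sub-Gaussian entries. Let $y_v=A_vx_v^\star$ for $v\in V$. Fix $\epsilon>0$. If $$N_{\text{Root}}\ \gtrsim\ \max\{s,\ \mathrm{Deg}(1)^2s'\}\big(\log(d)+\log(1/\epsilon)\big)$$ and $$N_{\text{Non-root}}\ \gtrsim\ \mathrm{Deg}(1)^2s'\big(\log(d)+\log(1/\epsilon)\big),$$ then with probability greater than $1-\epsilon$ the solution $\{x_v^{TVBP}\}_{v\in V}$ of the Total Variation Basis Pursuit problem with $\widetilde G=G$ is unique and satisfies $x_v^{TVBP}=x_v^\star$ for all $v\in V$.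
   Context: Sparsity: $\mathrm{Supp}(x)$ is the set of indices of nonzero coordinates of $x$. A collection $\{x_v^\star\}_{v\in V}\subset\mathbb{R}^d$ is $(G,s,s')$-sparse if $|\mathrm{Supp}(x_1^\star)|\le s$ (node $1$ is the root) and $|\mathrm{Supp}(x_v^\star-x_w^\star)|\le s'$ for every edge $(v,w)\in E$. Sub-Gaussian entries: a random matrix $A$ has i.i.d. sub-Gaussian entries if its entries are independent and identically distributed and $\mathbb{P}(|A_{ij}|\ge t)\le\beta e^{-\kappa t^2}$ for all $t\ge0$, for sub-Gaussian parameters $\beta$ and $\kappa$. Total Variation Basis Pursuit (TVBP): given a tree graph $\widetilde G=(V,\widetilde E)$, matrices $A_v$ and responses $y_v$, it is the optimisation problem $$\min_{x_1,\dots,x_n}\ \|x_1\|_1+\sum_{e=(v,w)\in\widetilde E}\|x_v-x_w\|_1\quad\text{subject to}\quad A_vx_v=y_v\ \text{ for } v\in V,$$ and a solution is denoted $\{x_v^{TVBP}\}_{v\in V}$. $\mathrm{Deg}(1)$ is the degree of the root node $1$ in $G$. The symbol $\gtrsim$ means $\ge$ up to a multiplicative constant depending only on the sub-Gaussian parameters $\beta,\kappa$.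
   Formalization: The entries are also assumed to have variance 1 (the tail bound alone admits the zero matrix, for which recovery fails), and if d=1 then ε≤1/2 is assumed (for d=1 and ε near 1, two mutually dependent matrices give a counterexample). *)

(* Defs.v *)
(* MathComp + MathComp-Analysis *)
From HB Require Import structures.
From mathcomp Require Import all_boot all_order all_algebra.
From mathcomp Require Import all_classical all_reals all_analysis.
Set Implicit Arguments.
Unset Strict Implicit.
Unset Printing Implicit Defensive.
Import Order.TTheory GRing.Theory Num.Theory.

Local Open Scope classical_set_scope.
Local Open Scope ring_scope.

(* A tree as a simple graph: adjacency relation that is symmetric,
   irreflexive, connected and without simple cycle. The bound on the size is
   needed because a single edge v - w gives the e-cycle [:: v; w]. *)
Definition is_tree (V : finType) (e : rel V) : Prop :=
  [/\ symmetric e, irreflexive e,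
      forall v w : V, connect e v w
    & forall c : seq V, (2 < size c)%N -> cycle e c -> ~~ uniq c].

Definition degree (V : finType) (e : rel V) (v : V) : nat := #|[set w | e v w]|.

Section Vectors.
Variables (R : realType) (d : nat).
Implicit Types x : 'cV[R]_d.

Definition l1norm x : R := \sum_(i < d) `|x i 0|.

Definition supp x : {set 'I_d} := [set i | x i 0 != 0]%SET.

End Vectors.

(* The vertex set {1, ..., n} is 'I_n with n = m.+1, and the root is ord0. *)
Section TVBP.
Variables (R : realType) (m d : nat).
Local Notation V := 'I_m.+1.

Definition graph_sparse (e : rel V) (s s' : nat) (x : V -> 'cV[R]_d) : Prop :=
  (#|supp (x ord0)| <= s)%N /\
  (forall v w : V, e v w -> (#|supp (x v - x w)| <= s')%N).

(* Each undirected edge is counted once, through its ordered pair v < w. *)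
Definition tvbp_objective (e : rel V) (x : V -> 'cV[R]_d) : R :=
  l1norm (x ord0) +
  \sum_(p : V * V | (p.1 < p.2)%N && e p.1 p.2) l1norm (x p.1 - x p.2).

Definition tvbp_feasible (N : V -> nat) (A : forall v : V, 'M[R]_(N v, d))
    (y : forall v : V, 'cV[R]_(N v)) (x : V -> 'cV[R]_d) : Prop :=
  forall v : V, A v *m x v = y v.

Definition is_tvbp_solution (e : rel V) (N : V -> nat)
    (A : forall v : V, 'M[R]_(N v, d)) (y : forall v : V, 'cV[R]_(N v))
    (x : V -> 'cV[R]_d) : Prop :=
  tvbp_feasible A y x /\
  (forall z : V -> 'cV[R]_d, tvbp_feasible A y z ->
     tvbp_objective e x <= tvbp_objective e z).

Definition sample_size (Nroot Nnon : nat) (v : V) : nat :=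
  if v == ord0 then Nroot else Nnon.

Definition node_matrix (Nroot Nnon : nat)
    (Aroot : 'M[R]_(Nroot, d)) (Anon : 'M[R]_(Nnon, d)) (v : V) :
    'M[R]_(sample_size Nroot Nnon v, d) :=
  if v == ord0 as b return 'M[R]_(if b then Nroot else Nnon, d)
  then (Num.sqrt Nroot%:R)^-1 *: Aroot
  else (Num.sqrt Nnon%:R)^-1 *: Anon.

End TVBP.

Section RandomMatrices.
Context {disp : measure_display} {T : measurableType disp} {R : realType}.
Variable P : probability T R.

Definition mutually_independent (I : finType) (X : I -> {RV P >-> R}) : Prop :=
  forall (J : {set I}) (B : I -> set R), (forall i, measurable (B i)) ->
    P (\bigcap_(i in [set` J]) (X i @^-1` B i)) =
    (\prod_(i in J) P (X i @^-1` B i))%E.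

Definition identically_distributed (I : finType) (X : I -> {RV P >-> R}) : Prop :=
  forall (i j : I) (B : set R), measurable B ->
    distribution P (X i) B = distribution P (X j) B.

Definition sub_gaussian (beta kappa : R) (X : {RV P >-> R}) : Prop :=
  forall t : R, 0 <= t ->
    (P [set w | (t <= `|X w|)%R] <= (beta * expR (- (kappa * t ^+ 2)))%:E)%E.

(* The tail bound alone allows degenerate entries (e.g. the zero matrix), for
   which no recovery is possible. The entries are therefore normalised to have
   variance 1, as usual for matrices that get rescaled by 1 / sqrt N; they need
   not be centred. *)
Definition iid_sub_gaussian (beta kappa : R) (N d : nat)
    (A : 'I_N -> 'I_d -> {RV P >-> R}) : Prop :=
  [/\ mutually_independent (fun ij : 'I_N * 'I_d => A ij.1 ij.2),
      identically_distributed (fun ij : 'I_N * 'I_d => A ij.1 ij.2),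
      forall i j, sub_gaussian beta kappa (A i j)
    & forall i j, variance P (A i j) = 1%:E].

Definition random_matrix (N d : nat) (A : 'I_N -> 'I_d -> {RV P >-> R}) (w : T) :
    'M[R]_(N, d) :=
  \matrix_(i < N, j < d) A i j w.

End RandomMatrices.

(* x is the unique solution of the TVBP problem with responses y_v = A_v x_v. *)
Definition tvbp_recovers (R : realType) (m d Nroot Nnon : nat)
    (e : rel 'I_m.+1) (Aroot : 'M[R]_(Nroot, d)) (Anon : 'M[R]_(Nnon, d))
    (x : 'I_m.+1 -> 'cV[R]_d) : Prop :=
  let A := node_matrix Aroot Anon in
  let y := fun v : 'I_m.+1 => A v *m x v in
  is_tvbp_solution e A y x /\
  (forall z : 'I_m.+1 -> 'cV[R]_d,
     is_tvbp_solution e A y z -> forall v, z v = x v).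

(* Main.v *)
Require Import Defs.
From HB Require Import structures.
From mathcomp Require Import all_boot all_order all_algebra.
From mathcomp Require Import all_classical all_reals all_analysis.
From mathcomp Require Import measurable_realfun ring lra zify.
Set Implicit Arguments.
Unset Strict Implicit.
Unset Printing Implicit Defensive.
Import Order.TTheory GRing.Theory Num.Theory.
Local Open Scope classical_set_scope.
Local Open Scope ring_scope.

(* Call a matrix A with l1_spread K A when every h in its kernel satisfies
   K |h|_2^2 <= |h|_1^2, so that |h_S|_1 <= sqrt(|S| / K) |h|_1 for all S.

   Deterministic part. Let h = z - xstar for a feasible z, so that h_1 is in
   ker Aroot and h_v in ker Anon for v <> 1. With K of order max(s, Deg(1)^2 s')
   for Aroot and Deg(1)^2 s' for Anon, the objective at z exceeds the objective
   at xstar by at least half the objective at h, because Anon is common to all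
   non-root nodes and only the Deg(1) root edges mix the two kernels.

   Random part. Subtracting rows in pairs gives a matrix B with symmetric
   entries whose kernel contains that of A. Expand
   |B z|^2 - a |z|^2 over an average z of M signed basis vectors drawn with
   mean h / |h|_1 (Maurey's empirical method): if the form is nonnegative at all
   the (2 d)^M such z and the columns of B have squared norm at most L, then
   a (M - 1) |h|_2^2 <= L |h|_1^2 on ker B. This needs only a union bound over
   finitely many z, and a lower tail for |B z|^2. For the latter,
   exp(-2 y^2) <= 1 - eta W + eta^2 W^2 with W = cosh y - 1, a combination of
   exponentials of y, so that its expectation over independent entries
   factorises into values of the moment generating function. *)

(** * Deterministic recovery *)

(** A quantitative null space property. It sees [A] only through its kernel, so it survives nonzero
    rescaling and passes to matrices with a smaller kernel. *)
Definition l1_spread (R : realType) (N d : nat) (K : R) (A : 'M[R]_(N, d)) : Prop :=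
  forall h : 'cV[R]_d, A *m h = 0 ->
    K * \sum_(i < d) h i 0 ^+ 2 <= l1norm h ^+ 2.

(** Cauchy-Schwarz, by expanding the square and using 2ab <= a^2 + b^2 termwise. *)
Lemma sqr_suml1_le (R : realType) (d : nat) (S : {set 'I_d}) (h : 'cV[R]_d) :
  (\sum_(i in S) `|h i 0|) ^+ 2 <= #|S|%:R * \sum_(i < d) h i 0 ^+ 2.
Proof.
have sumE : (\sum_(i in S) `|h i 0|) ^+ 2 =
    \sum_(i in S) \sum_(j in S) (`|h i 0| * `|h j 0|).
  by rewrite expr2 mulr_suml; apply: eq_bigr => i _; rewrite mulr_sumr.
have leS : \sum_(i in S) h i 0 ^+ 2 <= \sum_(i < d) h i 0 ^+ 2.
  rewrite [leRHS](bigID (mem S)) /= lerDl.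
  by apply: sumr_ge0 => i _; exact: sqr_ge0.
apply: (le_trans _ (ler_wpM2l (ler0n _ _) leS)).
have -> : #|S|%:R * \sum_(i in S) h i 0 ^+ 2 =
    \sum_(i in S) \sum_(j in S) ((h i 0 ^+ 2 + h j 0 ^+ 2) / 2).
  set Q := \sum_(i in S) h i 0 ^+ 2.
  have rowE i : \sum_(j in S) ((h i 0 ^+ 2 + h j 0 ^+ 2) / 2) =
      (#|S|%:R * h i 0 ^+ 2 + Q) / 2.
    by rewrite -mulr_suml big_split /= sumr_const -[_ *+ #|_|]mulr_natl.
  under eq_bigr => i _ do rewrite rowE.
  rewrite -mulr_suml big_split /= sumr_const -[_ *+ #|_|]mulr_natl -mulr_sumr -/Q.
  by field.
rewrite sumE; apply: ler_sum => i _; apply: ler_sum => j _.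
rewrite -(real_normK (num_real (h i 0))) -(real_normK (num_real (h j 0))).
by have := sqr_ge0 (`|h i 0| - `|h j 0|); rewrite sqrrB; lra.
Qed.

Lemma l1norm_ge0 (R : realType) (d : nat) (x : 'cV[R]_d) : 0 <= l1norm x.
Proof. by apply: sumr_ge0. Qed.

Lemma l1norm_eq0 (R : realType) (d : nat) (x : 'cV[R]_d) : l1norm x <= 0 -> x = 0.
Proof.
move=> x0; apply/matrixP => i j; rewrite ord1 mxE.
apply/eqP; rewrite -normr_eq0 eq_le normr_ge0 andbT (le_trans _ x0)//.
by rewrite /l1norm (bigD1 i) //= lerDl; apply: sumr_ge0.
Qed.

(** Off the support of [x] the coordinates of [x + g] are those of [g]; on it, |x_i + g_i| >= |x_i|
    - |g_i|, a deficit of 2|g_i|. *)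
Lemma l1normD_ge (R : realType) (d : nat) (x g : 'cV[R]_d) :
  l1norm x + l1norm g - 2 * (\sum_(i in supp x) `|g i 0|) <= l1norm (x + g).
Proof.
rewrite lerBlDr /l1norm -big_split /= mulr_sumr [X in _ <= _ + X]big_mkcond.
rewrite -big_split /=; apply: ler_sum => i _; rewrite mxE inE.
have [->|_] := eqVneq (x i 0) 0; first by rewrite /= normr0 !add0r addr0.
by rewrite /=; have := lerB_normD (x i 0) (g i 0); lra.
Qed.

Lemma l1norm_triangle (R : realType) (d : nat) (x y : 'cV[R]_d) :
  l1norm (x + y) <= l1norm x + l1norm y.
Proof.
by rewrite /l1norm -big_split; apply: ler_sum => i _; rewrite mxE ler_normD.
Qed.

Lemma l1normN (R : realType) (d : nat) (x : 'cV[R]_d) : l1norm (- x) = l1norm x.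
Proof. by apply: eq_bigr => i _; rewrite mxE normrN. Qed.

(** As 1024 = 32^2, the bound (32c)^2 |S| <= 1024 k combines with Cauchy-Schwarz. It serves with c =
    1 at the root and with c the root degree on edges. *)
Lemma l1_spread_supp (R : realType) (N d k s c : nat) (A : 'M[R]_(N, d))
    (h : 'cV[R]_d) (S : {set 'I_d}) :
  l1_spread ((1024 * k)%:R) A -> A *m h = 0 -> (#|S| <= s)%N ->
  (c ^ 2 * s <= k)%N ->
  32 * c%:R * \sum_(i in S) `|h i 0| <= l1norm h.
Proof.
move=> /(_ h) /[apply] Ah Ss sk.
have h2 : 0 <= \sum_(i < d) h i 0 ^+ 2 by apply: sumr_ge0 => i _; exact: sqr_ge0.
rewrite -ler_sqr ?nnegrE ?l1norm_ge0//; last first.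
  by rewrite mulr_ge0 ?sumr_ge0//.
rewrite exprMn; apply: (le_trans _ Ah).
apply: (le_trans (ler_wpM2l (sqr_ge0 _) (sqr_suml1_le S h))).
have cE : 32 * c%:R = (32 * c)%:R :> R by rewrite natrM.
rewrite mulrA ler_wpM2r// cE -natrX -natrM ler_nat expnMn -mulnA leq_mul2l /=.
by rewrite (leq_trans _ sk)// leq_mul2l Ss orbT.
Qed.

Lemma node_matrix_kernel (R : realType) (m d Nroot Nnon : nat)
    (Aroot : 'M[R]_(Nroot, d)) (Anon : 'M[R]_(Nnon, d)) (v : 'I_m.+1)
    (h : 'cV[R]_d) :
  node_matrix Aroot Anon v *m h = 0 ->
  if v == ord0 then Aroot *m h = 0 else Anon *m h = 0.
Proof.
have scale0 N (A : 'M[R]_(N, d)) : (Num.sqrt N%:R)^-1 *: A *m h = 0 -> A *m h = 0.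
  (* For N = 0 the scalar is 0 by the convention on inverses, but a matrix without rows kills every
     vector. *)
  case: N A => [|N] A; first by move=> _; apply/matrixP; case.
  rewrite -scalemxAl => /eqP; rewrite scaler_eq0 => /orP[|/eqP//].
  by rewrite invr_eq0 sqrtr_eq0 lern0.
by rewrite /node_matrix /sample_size; case: (v == ord0); exact: scale0.
Qed.

Lemma degreeE (V : finType) (e : rel V) (v : V) : degree e v = #|e v|.
Proof. by apply: eq_card => w; apply/idP/idP; rewrite in_setE. Qed.

(* Writing [b] for the root component of [h], an edge [(v, w)] that avoids the
   root has [h v - h w] in the kernel of [Anon]. An edge [(1, w)] loses at most
   [2 (|b_S| + |(h w)_S|)], which is [O((|b| + |h w|) / degree)], and there are
   [degree] such edges. *)
Lemma tvbp_objective_gap (R : realType) (m d s s' Nroot Nnon : nat)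
    (e : rel 'I_m.+1) (Aroot : 'M[R]_(Nroot, d)) (Anon : 'M[R]_(Nnon, d))
    (x h : 'I_m.+1 -> 'cV[R]_d) (D := degree e ord0) :
  graph_sparse e s s' x ->
  (forall v w : 'I_m.+1, e v w -> (0 < D)%N) ->
  l1_spread (1024 * maxn s (D ^ 2 * s'))%:R Aroot ->
  l1_spread (1024 * (D ^ 2 * s'))%:R Anon ->
  (forall v, if v == ord0 then Aroot *m h v = 0 else Anon *m h v = 0) ->
  tvbp_objective e x + tvbp_objective e h / 2 <=
  tvbp_objective e (fun v => x v + h v).
Proof.
move=> [x0s xes] Dgt0 spr spn kerh.
set b := h ord0.
have kerb : Aroot *m b = 0 by exact: (kerh ord0).
(* The support costs at most 2/32 = 1/16 of the norm of [b]. *)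
have rootE : l1norm (x ord0) + (15 / 16) * l1norm b <= l1norm (x ord0 + b).
  apply: (le_trans _ (l1normD_ge _ _)).
  have := @l1_spread_supp _ _ _ _ s 1 _ b (supp (x ord0)) spr kerb x0s.
  by rewrite exp1n mul1n leq_maxl => /(_ isT); lra.
(* Since p.1 < p.2, only the first endpoint can be the root; the additional loss is charged to root
   edges alone. *)
have edgeE (p : 'I_m.+1 * 'I_m.+1) : (p.1 < p.2)%N && e p.1 p.2 ->
    l1norm (x p.1 - x p.2) + (15 / 16) * l1norm (h p.1 - h p.2)
      - (if p.1 == ord0 then l1norm b / (4 * D%:R) else 0)
    <= l1norm (x p.1 + h p.1 - (x p.2 + h p.2)).
  case: p => v w /= /andP[vw evw].
  have D0 : 1 <= D%:R :> R by rewrite ler1n (Dgt0 _ _ evw).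
  have -> : x v + h v - (x w + h w) = (x v - x w) + (h v - h w).
    by rewrite opprD addrACA.
  apply: (le_trans _ (l1normD_ge _ _)).
  set S := supp _; have Ss : (#|S| <= s')%N := xes _ _ evw.
  have w0 : w == ord0 = false by apply/negbTE/eqP => w0; rewrite w0 in vw.
  have kerw : Anon *m h w = 0 by have := kerh w; rewrite w0.
  case: eqP => [v0|/eqP/negbTE v0].
    have hb := @l1_spread_supp _ _ _ _ _ D _ b S spr kerb Ss (leq_maxr _ _).
    have hw := @l1_spread_supp _ _ _ _ _ D _ (h w) S spn kerw Ss (leqnn _).
    have hS : \sum_(i in S) `|(h v - h w) i 0| <=
        \sum_(i in S) `|b i 0| + \sum_(i in S) `|h w i 0|.
      rewrite -big_split; apply: ler_sum => i _; rewrite /b v0 !mxE.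
      exact: ler_normB.
    have hwb : l1norm (h w) <= l1norm b + l1norm (h v - h w).
      have hwE : h w = b + - (h v - h w) by rewrite /b v0 opprB addrC subrK.
      by rewrite {1}hwE (le_trans (l1norm_triangle _ _))// l1normN.
    have b0 := l1norm_ge0 b; have g0 := l1norm_ge0 (h v - h w).
    set bS := \sum_(i in S) `|b i 0| in hb hS.
    set wS := \sum_(i in S) `|h w i 0| in hw hS.
    set gS := \sum_(i in S) `|_| in hS *.
    have {hb hw} hbw : 32 * (bS + wS) <=
        2 * (l1norm b / D%:R) + l1norm (h v - h w) / D%:R.
      rewrite mulrA -mulrDl ler_pdivlMr; last by lra.
      by rewrite mulrAC mulrDr; lra.
    have D1 : l1norm (h v - h w) / D%:R <= l1norm (h v - h w).
      by rewrite ler_pdivrMr; [rewrite ler_peMr|lra].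
    have -> : l1norm b / (4 * D%:R) = (l1norm b / D%:R) / 4.
      by field; rewrite gt_eqF//; lra.
    have b1 : 0 <= l1norm b / D%:R by rewrite divr_ge0 ?ler0n.
    lra.
  have kervw : Anon *m (h v - h w) = 0.
    by have := kerh v; rewrite v0 mulmxBr kerw => ->; rewrite subr0.
  have := @l1_spread_supp _ _ _ _ _ D _ _ S spn kervw Ss (leqnn _).
  have : 0 <= \sum_(i in S) `|(h v - h w) i 0| by apply: sumr_ge0.
  set gS := \sum_(i in S) _; move=> gS0 hgS.
  have : gS <= D%:R * gS by rewrite ler_peMl.
  by rewrite -mulrA in hgS; lra.
(* At most [D] root edges, each charged |b| / (4D), cost |b| / 4 together. *)
have rootsE : \sum_(p : 'I_m.+1 * 'I_m.+1 | (p.1 < p.2)%N && e p.1 p.2)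
    (if p.1 == ord0 then l1norm b / (4 * D%:R) else 0) <= l1norm b / 4.
  rewrite -big_mkcondr /=.
  rewrite (eq_bigl (fun p => p \in [set p : 'I_m.+1 * 'I_m.+1 |
     (p.1 < p.2)%N && e p.1 p.2 && (p.1 == ord0)]%SET)); last by move=> p; rewrite inE.
  rewrite sumr_const.
  set Q := [set _ | _]%SET.
  have QD : (#|Q| <= D)%N.
    have inj : {in Q &, injective (fun p : 'I_m.+1 * 'I_m.+1 => p.2)}.
      move=> [v w] [v' w']; rewrite !inE /= => /andP[_ /eqP->] /andP[_ /eqP->].
      by move=> ->.
    rewrite -(card_in_imset inj) /D degreeE; apply: subset_leq_card.
    apply/fintype.subsetP => w /imsetP[[v' w']]; rewrite inE /=.
    by move=> /andP[/andP[_ evw] /eqP v0] ->; rewrite -v0.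
  have [->|Q0] := posnP #|Q|; first by rewrite mulr0n divr_ge0 ?l1norm_ge0.
  have D0 : 0 < D%:R :> R by rewrite ltr0n (leq_trans Q0).
  rewrite -[_ *+ #|_|]mulr_natr (@le_trans _ _ (l1norm b / (4 * D%:R) * D%:R))//.
    by rewrite ler_wpM2l ?ler_nat// divr_ge0 ?l1norm_ge0// mulr_ge0// ltW.
  by rewrite le_eqVlt; apply/orP; left; apply/eqP; field; rewrite gt_eqF.
(* The root term keeps 15/16 - 1/4 of its norm and each edge 15/16; both exceed 1/2. *)
have := ler_sum (index_enum ('I_m.+1 * 'I_m.+1)%type) edgeE.
rewrite sumrB big_split /= -mulr_sumr => sumE.
rewrite /tvbp_objective -/b.
have b0 := l1norm_ge0 b.
have : 0 <= \sum_(p : 'I_m.+1 * 'I_m.+1 | (p.1 < p.2)%N && e p.1 p.2)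
  l1norm (h p.1 - h p.2) by apply: sumr_ge0 => p _; exact: l1norm_ge0.
lra.
Qed.

(** An edge provides a vertex other than [r], and a path from [r] to it starts with an edge at [r].
    A one-vertex tree has degree 0, hence the edge as hypothesis. *)
Lemma degree_gt0 (V : finType) (e : rel V) (r v w : V) :
  is_tree e -> e v w -> (0 < degree e r)%N.
Proof.
move=> [_ irr con _] evw.
have [u ur] : exists u, u != r.
  have [vr|vr] := eqVneq v r; last by exists v.
  exists w; apply/eqP => wr; move: evw; rewrite vr wr irr //.
have /connectP[p] := con r u.
case: p => [|a p] /=; first by move=> _ ur'; rewrite ur' eqxx in ur.
by move=> /andP[era _] _; rewrite degreeE; apply/card_gt0P; exists a.
Qed.

(** All terms vanish, so [h] is zero at the root and constant along edges; connectedness carries the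
    zero to every vertex. *)
Lemma tvbp_objective_le0 (R : realType) (m d : nat) (e : rel 'I_m.+1)
    (h : 'I_m.+1 -> 'cV[R]_d) :
  is_tree e -> tvbp_objective e h <= 0 -> forall v, h v = 0.
Proof.
move=> [sym irr con _] h0.
have edge_ge0 (p : 'I_m.+1 * 'I_m.+1) : (p.1 < p.2)%N && e p.1 p.2 ->
  0 <= l1norm (h p.1 - h p.2) by move=> _; exact: l1norm_ge0.
have sum_ge0 := sumr_ge0 (index_enum ('I_m.+1 * 'I_m.+1)%type) edge_ge0.
have root0 : h ord0 = 0.
  apply: l1norm_eq0; have := l1norm_ge0 (h ord0).
  by move: h0; rewrite /tvbp_objective; lra.
have lt0 (v w : 'I_m.+1) : (v < w)%N -> e v w -> h v = h w.
  move=> vw evw; apply/eqP; rewrite -subr_eq0; apply/eqP/l1norm_eq0.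
  have := l1norm_ge0 (h ord0); move: h0; rewrite /tvbp_objective.
  rewrite (bigD1 (v, w)) ?vw ?evw //= => h0 h1.
  have : 0 <= \sum_(p : 'I_m.+1 * 'I_m.+1 | (p.1 < p.2)%N && e p.1 p.2 && (p != (v, w)))
    l1norm (h p.1 - h p.2) by apply: sumr_ge0 => p _; exact: l1norm_ge0.
  lra.
have edge0 (v w : 'I_m.+1) : e v w -> h v = h w.
  move=> evw; case: (ltngtP v w) => [vw|wv|/val_inj vw]; first exact: lt0.
    by apply/esym/lt0; rewrite // sym.
  by rewrite vw irr in evw.
move=> v; have /connectP[p + ->] := con ord0 v.
elim: p (ord0 : 'I_m.+1) root0 => [|a p ih] r r0 //= /andP[era pa].
by apply: ih => //; rewrite -(edge0 _ _ era).
Qed.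

(** The gap inequality gives optimality of [x]; for another solution [z] it forces the objective at
    [z - x] to be at most 0. *)
Lemma l1_spread_tvbp_recovers (R : realType) (m d s s' Nroot Nnon : nat)
    (e : rel 'I_m.+1) (Aroot : 'M[R]_(Nroot, d)) (Anon : 'M[R]_(Nnon, d))
    (x : 'I_m.+1 -> 'cV[R]_d) (D := degree e ord0) :
  is_tree e -> graph_sparse e s s' x ->
  l1_spread (1024 * maxn s (D ^ 2 * s'))%:R Aroot ->
  l1_spread (1024 * (D ^ 2 * s'))%:R Anon ->
  tvbp_recovers e Aroot Anon x.
Proof.
move=> tree sparse spr spn.
have gap (z : 'I_m.+1 -> 'cV[R]_d) :
    tvbp_feasible (node_matrix Aroot Anon)
      (fun v => node_matrix Aroot Anon v *m x v) z ->
    tvbp_objective e x + tvbp_objective e (fun v => z v - x v) / 2 <=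
    tvbp_objective e z.
  move=> feas.
  have -> : tvbp_objective e z = tvbp_objective e (fun v => x v + (z v - x v)).
    by congr tvbp_objective; apply/funext => v; rewrite addrC subrK.
  apply: (tvbp_objective_gap sparse _ spr spn).
    by move=> v w; exact: degree_gt0.
  move=> v; apply: node_matrix_kernel.
  by rewrite mulmxBr (feas v) subrr.
have obj_ge0 (z : 'I_m.+1 -> 'cV[R]_d) : 0 <= tvbp_objective e z.
  by rewrite addr_ge0 ?l1norm_ge0// sumr_ge0// => p _; exact: l1norm_ge0.
have feasx : tvbp_feasible (node_matrix Aroot Anon)
  (fun v => node_matrix Aroot Anon v *m x v) x by [].
split=> [|z [feas /(_ x feasx) zmin] v].
  split=> // z /gap; have := obj_ge0 (fun v => z v - x v); lra.
apply/eqP; rewrite -subr_eq0; apply/eqP.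
apply: (tvbp_objective_le0 (h := fun v => z v - x v) tree).
by have := gap _ feas; lra.
Qed.

(** * From sums of basis vectors to the kernel *)

(* Maurey's empirical method: the bound is the average of the hypothesis over
   [t] with [M] independent entries drawn from [lam]. *)
Lemma empirical_quadratic_form (R : realDomainType) (V : lmodType R)
    (bil : V -> V -> R) (J : finType) (lam : J -> R) (u : J -> V) (M : nat) (w : V)
    (h := \sum_j lam j *: u j) :
  (forall x y, bil x y = bil y x) ->
  (forall x y z, bil x (y + z) = bil x y + bil x z) ->
  (forall a x y, bil x (a *: y) = a * bil x y) ->
  (forall j, 0 <= lam j) -> \sum_j lam j = 1 ->
  (forall t : seq J, size t = M ->
    0 <= bil (w + \sum_(j <- t) u j) (w + \sum_(j <- t) u j)) ->
  0 <= bil w w + 2 * M%:R * bil w h + M%:R * (\sum_j lam j * bil (u j) (u j))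
    + M%:R * (M%:R - 1) * bil h h.
Proof.
move=> bilC bilD bilZ lam0 lam1.
have bil_h x : \sum_j lam j * bil x (u j) = bil x h.
  have bil0 : bil x 0 = 0 by rewrite -(scale0r 0) bilZ mul0r.
  rewrite /h; elim/big_rec2: _ => [|j y v _ bilv]; first by rewrite bil0.
  by rewrite bilD bilZ bilv.
set D := \sum_j lam j * bil (u j) (u j).
(* The first draw is absorbed into [w]; averaging the induction hypothesis at [w + u j] over [lam]
   gives the claim for one more draw. *)
elim: M w => [|M IH] w hyp.
  by have := hyp [::] erefl; rewrite big_nil addr0; lra.
have step j : 0 <= bil (w + u j) (w + u j) + 2 * M%:R * bil (w + u j) h + M%:R * D
    + M%:R * (M%:R - 1) * bil h h.
  apply: IH => t st; have := hyp (j :: t); rewrite /= st => /(_ erefl).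
  by rewrite big_cons addrA.
have bil2 x y : bil (x + y) (x + y) = bil x x + 2 * bil x y + bil y y.
  by rewrite bilD bilC bilD (bilC (x + y)) bilD (bilC y x); ring.
have : 0 <= \sum_j lam j * (bil (w + u j) (w + u j) + 2 * M%:R * bil (w + u j) h
    + M%:R * D + M%:R * (M%:R - 1) * bil h h).
  by apply: sumr_ge0 => j _; rewrite mulr_ge0.
have -> : \sum_j lam j * (bil (w + u j) (w + u j) + 2 * M%:R * bil (w + u j) h
    + M%:R * D + M%:R * (M%:R - 1) * bil h h) =
  \sum_j (lam j * (bil w w + 2 * M%:R * bil w h + M%:R * D
           + M%:R * (M%:R - 1) * bil h h)
    + 2 * (lam j * bil w (u j)) + lam j * bil (u j) (u j)
    + 2 * M%:R * (lam j * bil h (u j))).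
  apply: eq_bigr => j _; rewrite bil2 (bilC _ h) bilD (bilC h w); ring.
rewrite !big_split /= -mulr_suml lam1 mul1r -!mulr_sumr !bil_h -/D.
by rewrite -natr1 => H; apply: (le_trans H); rewrite le_eqVlt; apply/orP; left;
  apply/eqP; ring.
Qed.

Definition sqnorm (R : realType) (d : nat) (x : 'cV[R]_d) : R :=
  \sum_(i < d) x i 0 ^+ 2.

(** The vertices of the l1 unit ball; [true] stands for the minus sign. *)
Definition sgn_basis (R : realType) (d : nat) (jb : 'I_d * bool) : 'cV[R]_d :=
  (-1) ^+ jb.2 *: delta_mx jb.1 0.

Lemma sqnorm_basis (R : realType) (d : nat) (jb : 'I_d * bool) :
  sqnorm (sgn_basis R jb) = 1.
Proof.
rewrite /sqnorm (bigD1 jb.1) //= big1 => [|i /negbTE ij].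
  by rewrite !mxE !eqxx mulr1 addr0 sqrr_sign.
by rewrite !mxE ij mulr0 expr0n.
Qed.

Lemma sqnorm_mul_basis (R : realType) (n d : nat) (B : 'M[R]_(n, d))
    (jb : 'I_d * bool) :
  sqnorm (B *m sgn_basis R jb) = sqnorm (col jb.1 B).
Proof.
apply: eq_bigr => i _; rewrite -scalemxAr -colE !mxE exprMn sqrr_sign mul1r.
by [].
Qed.

(** The empirical method is applied to the form |B x|^2 - a |x|^2, whose value at h / |h|_1 is -a
    |h|_2^2 / |h|_1^2 because B h = 0. *)
Lemma l1_spread_kernel (R : realType) (n d M : nat) (B : 'M[R]_(n, d)) (a L : R)
    (h : 'cV[R]_d) :
  0 <= a ->
  (forall t : seq ('I_d * bool), size t = M.+1 ->
    a * sqnorm (\sum_(j <- t) sgn_basis R j) <=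
    sqnorm (B *m \sum_(j <- t) sgn_basis R j)) ->
  (forall j, sqnorm (col j B) <= L) ->
  B *m h = 0 -> a * M%:R * sqnorm h <= L * l1norm h ^+ 2.
Proof.
move=> a0 low up Bh.
have [h0|hpos] := leP (l1norm h) 0.
  rewrite (l1norm_eq0 h0) /sqnorm big1 ?mulr0; last by move=> i _; rewrite mxE expr0n.
  by rewrite /l1norm big1 ?expr0n ?mulr0// => i _; rewrite mxE normr0.
pose dot k (x y : 'cV[R]_k) := \sum_(i < k) x i 0 * y i 0.
have dotE k (x : 'cV[R]_k) : dot k x x = sqnorm x by apply: eq_bigr => i _; rewrite expr2.
have dotC k x y : dot k x y = dot k y x by apply: eq_bigr => i _; rewrite mulrC.
have dotD k x y z : dot k x (y + z) = dot k x y + dot k x z.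
  by rewrite -big_split; apply: eq_bigr => i _; rewrite mxE mulrDr.
have dotZ k b x y : dot k x (b *: y) = b * dot k x y.
  by rewrite mulr_sumr; apply: eq_bigr => i _; rewrite mxE mulrCA.
pose bil x y := dot n (B *m x) (B *m y) - a * dot d x y.
(* Mass |h_j| / |h|_1 sits on the basis vector carrying the sign of h_j, so the mean is h /
   |h|_1. *)
pose lam (jb : 'I_d * bool) :=
  if jb.2 == (h jb.1 0 < 0) then `|h jb.1 0| / l1norm h else 0.
have sum_lam (U : nmodType) (F : 'I_d * bool -> U) :
    (forall jb, jb.2 != (h jb.1 0 < 0) -> F jb = 0) ->
    \sum_jb F jb = \sum_j F (j, h j 0 < 0).
  move=> F0; transitivity (\sum_j \sum_b F (j, b)).
    by rewrite pair_bigA; apply: eq_bigr => -[].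
  apply: eq_bigr => j _; rewrite (bigD1 (h j 0 < 0)) //= big1 ?addr0// => b bh.
  exact: F0.
have lam1 : \sum_jb lam jb = 1.
  rewrite sum_lam => [|jb /negbTE jbh]; last by rewrite /lam jbh.
  under eq_bigr do rewrite /lam /= eqxx.
  by rewrite -mulr_suml divff// gt_eqF.
have hE : \sum_jb lam jb *: sgn_basis R jb = (l1norm h)^-1 *: h.
  rewrite sum_lam => [|jb /negbTE jbh]; last by rewrite /lam jbh scale0r.
  apply/matrixP => i k; rewrite ord1 {k} summxE (bigD1 i) //= big1 => [|j].
    by rewrite /lam /= eqxx !mxE !eqxx mulr1 addr0 mulrAC (mulrC `|_|) -numEsign mulrC.
  by rewrite eq_sym => /negbTE ji; rewrite !mxE ji !mulr0.
have := @empirical_quadratic_form R _ bil _ lam (@sgn_basis R d) M.+1 0.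
lazy zeta; rewrite hE.
have bil0 x : bil 0 x = 0.
  rewrite /bil mulmx0 /dot !big1 ?mulr0 ?subr0// => i _; rewrite mxE mul0r//.
rewrite !bil0 mulr0 !add0r.
have -> : bil ((l1norm h)^-1 *: h) ((l1norm h)^-1 *: h) =
    - (a * sqnorm h / l1norm h ^+ 2).
  rewrite /bil -scalemxAr Bh scaler0 dotZ (dotC d) dotZ !dotE.
  rewrite [sqnorm 0]big1 => [|i _]; last by rewrite mxE expr0n.
  by field; rewrite gt_eqF.
set Q := \sum_j (lam j * bil _ _) => H.
have QL : Q <= L.
  rewrite -[L]mul1r -[X in X * L]lam1 mulr_suml; apply: ler_sum => jb _.
  rewrite ler_wpM2l//.
    by rewrite /lam; case: ifP => // _; rewrite divr_ge0 ?l1norm_ge0.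
  rewrite /bil !dotE sqnorm_mul_basis sqnorm_basis.
  by have := up jb.1; lra.
have : 0 <= M.+1%:R * Q + M.+1%:R * (M.+1%:R - 1) * - (a * sqnorm h / l1norm h ^+ 2).
  apply: H => //.
  - by move=> x y; rewrite /bil dotC (dotC d).
  - by move=> x y z; rewrite /bil mulmxDr !dotD; ring.
  - by move=> b x y; rewrite /bil -scalemxAr !dotZ; ring.
  - by move=> jb; rewrite /lam; case: ifP => // _; rewrite divr_ge0 ?l1norm_ge0.
  - by move=> t st; rewrite add0r /bil !dotE subr_ge0; exact: low.
(* The quadratic term has factor (M + 1) M and the diagonal term M + 1; cancelling M + 1 leaves
   [M]. *)
rewrite -mulrA -mulrDr pmulr_rge0 ?ltr0n// -natr1 addrK mulrN subr_ge0 => H1.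
have := le_trans H1 QL.
by rewrite mulrA ler_pdivrMr ?exprn_gt0// mulrA (mulrC _ a).
Qed.

(** * Expectations of products of independent variables *)

Section SimpleFunctions.
Import HBNNSimple.

(** An identity tested on indicators extends to nonnegative measurable functions by simple
    approximation and monotone convergence. *)
Lemma ge0_integral_mul_comp disp (T : measurableType disp) (R : realType)
    (P : {measure set T -> \bar R}) (X : {mfun T >-> R}) (g1 g2 : T -> R) (f : R -> R) :
  measurable_fun setT g1 -> measurable_fun setT g2 -> measurable_fun [set: R] f ->
  (forall w, 0 <= g1 w) -> (forall w, 0 <= g2 w) -> (forall x, 0 <= f x) ->
  (forall B : set R, measurable B ->
    (\int[P]_w (g1 w * \1_B (X w))%:E = \int[P]_w (g2 w * \1_B (X w))%:E)%E) ->
  (\int[P]_w (g1 w * f (X w))%:E = \int[P]_w (g2 w * f (X w))%:E)%E.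
Proof.
move=> mg1 mg2 mf g10 g20 f0 g12.
have mEf : measurable_fun [set: R] (EFin \o f) by exact/measurable_EFinP.
pose f_ := nnsfun_approx measurableT mEf.
(* The limit depends on [g] only through integrals over level sets of the approximations, where the
   hypothesis on indicators applies. *)
suff key (g : T -> R) : measurable_fun setT g -> (forall w, 0 <= g w) ->
    (\int[P]_w (g w * f (X w))%:E = limn (fun n => \sum_(r \in range (f_ n))
      (r%:E * \int[P]_w (g w * \1_(f_ n @^-1` [set r]) (X w))%:E)))%E.
  rewrite !key//; congr (limn _); apply/funext => n.
  by apply: eq_fsbigr => r _; rewrite g12//; exact: measurable_funPTI.
move=> mg g0.
have mterm n r : measurable_fun setT (fun w => g w * \1_(f_ n @^-1` [set r]) (X w)).
  apply: measurable_funM => //.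
  by apply: (measurableT_comp _ (@measurable_funPT _ _ _ _ X)).
transitivity (\int[P]_w limn (fun n => (g w * f_ n (X w))%:E))%E.
  apply: eq_integral => w _; apply/esym/cvg_lim => //=.
  under eq_fun do rewrite EFinM; rewrite EFinM.
  apply: cvgeZl => //.
  by apply: (@cvg_nnsfun_approx _ _ _ setT measurableT _ mEf) => // x _; rewrite lee_fin.
rewrite monotone_convergence//=.
- congr (limn _); apply/funext => n.
  transitivity (\int[P]_w (\sum_(r \in range (f_ n))
      (r%:E * (g w * \1_(f_ n @^-1` [set r]) (X w))%:E)))%E.
    apply: eq_integral => w _; rewrite fimfunE mulr_fsumr -fsumEFin//.
    by apply: eq_fsbigr => r _; rewrite -EFinM mulrCA.
  rewrite ge0_integral_fsum//=.
  + apply: eq_fsbigr => r _.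
    have [r0|r0] := leP 0 r.
      rewrite ge0_integralZl_EFin//=.
      * by move=> w _; rewrite lee_fin mulr_ge0.
      * by apply/measurable_EFinP; exact: mterm.
    rewrite preimage_nnfun0// integral0_eq => [|w _]; last first.
      by rewrite indicE in_set0 mulr0 mule0.
    rewrite integral0_eq ?mule0// => w _.
    by rewrite indicE in_set0 mulr0.
  + by move=> r; apply/measurable_EFinP; exact: measurable_funM.
  + move=> r w _; have [r0|r0] := leP 0 r; first by rewrite -EFinM lee_fin !mulr_ge0.
    by rewrite preimage_nnfun0// indicE in_set0 mulr0 mule0.
- move=> n; apply/measurable_EFinP; apply: measurable_funM => //.
  exact: measurableT_comp.
- by move=> n w _; rewrite lee_fin mulr_ge0.
- move=> w _ a b ab; rewrite lee_fin ler_wpM2l//.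
  exact/lefP/nd_nnsfun_approx.
Qed.

End SimpleFunctions.

Section ProductFormula.
Context {disp : measure_display} {T : measurableType disp} {R : realType}.
Variables (P : probability T R) (I : finType) (X : I -> {RV P >-> R}).

Lemma measurable_prod_comp (Q : pred I) (h : I -> R -> R) :
  (forall i, measurable_fun [set: R] (h i)) ->
  measurable_fun setT (fun w => \prod_(i | Q i) h i (X i w)).
Proof.
move=> mh; elim: (index_enum _) => [|i s IH].
  by under eq_fun do rewrite big_nil; exact: measurable_cst.
under eq_fun do rewrite big_cons; case: (Q i) => //.
apply: measurable_funM => //.
by apply: (measurableT_comp (mh i) (@measurable_funPT _ _ _ _ (X i))).
Qed.

Lemma integral_indic_comp (i : I) (B : set R) : measurable B ->
  (\int[P]_w (\1_B (X i w))%:E = P (X i @^-1` B))%E.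
Proof.
move=> mB; rewrite -[X in _ = P X]setIT -integral_indic//.
exact: measurable_funPTI.
Qed.

Lemma preimage_fin_num (i : I) (B : set R) : measurable B ->
  P (X i @^-1` B) \is a fin_num.
Proof. by move=> mB; apply: fin_num_measure; exact: measurable_funPTI. Qed.

(* Indicators are replaced by general factors one index at a time. *)
Lemma independent_integral_prod (h : I -> R -> R) (c : I -> R) :
  mutually_independent X ->
  (forall i, measurable_fun [set: R] (h i)) -> (forall i x, 0 <= h i x) ->
  (forall i, \int[P]_w (h i (X i w))%:E = (c i)%:E)%E ->
  (\int[P]_w (\prod_i h i (X i w))%:E = (\prod_i c i)%:E)%E.
Proof.
move=> indX.
(* Induction on the list [s] of indices with general factors; outside [s] the factors are
   indicators. *)
suff claim (s : seq I) : forall (h : I -> R -> R) (c : I -> R),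
    (forall i, i \notin s -> exists2 B : set R, measurable B & h i = \1_B) ->
    (forall i, measurable_fun [set: R] (h i)) -> (forall i x, 0 <= h i x) ->
    (forall i, \int[P]_w (h i (X i w))%:E = (c i)%:E)%E ->
    (\int[P]_w (\prod_i h i (X i w))%:E = (\prod_i c i)%:E)%E.
  by apply: (claim (enum I)) => i; rewrite mem_enum.
elim: s => [|k s IH] {}h {}c hs mh h0 hc.
  (* With indicators only, the product is the indicator of an intersection, and independence applies
     to the full index set. *)
  have hB i : {B : set R | measurable B & h i = \1_B} by exact/cid2/hs.
  pose B i := s2val (hB i).
  have mB i : measurable (B i) by rewrite /B; case: (hB i).
  have hE i : h i = \1_(B i) by rewrite /B; case: (hB i).
  have cE i : (P (X i @^-1` B i) = (c i)%:E)%E.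
    by rewrite -hc hE integral_indic_comp.
  have := indX [set: I]%SET B mB.
  rewrite (eq_bigr _ (fun i _ => cE i)).
  rewrite -(big_morph EFin (@EFinM R) (erefl _)) (eq_bigl xpredT);
    last by move=> i; rewrite inE.
  move=> <-.
  rewrite -[X in _ = P X]setIT -integral_indic//=; last first.
    apply: fin_bigcap_measurable => // i _; exact: measurable_funPTI.
  apply: eq_integral => w _; congr EFin; rewrite indicE.
  under eq_bigr do rewrite hE indicE.
  have [wB|wB] := boolP (w \in _).
    rewrite big1// => i _; rewrite mem_set//.
    by move: wB; rewrite inE => /(_ i); apply; rewrite /= inE.
  rewrite mulr0n; apply/eqP/prodf_eq0.
  have : ~ (\bigcap_(i in [set` [set: I]%SET]) X i @^-1` B i) w.
    by move=> wX; move: wB; rewrite notin_setE.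
  move=> /existsNP[i /not_implyP[_ Bi]]; exists i => //.
  by rewrite (@memNset _ (B i) (X i w) Bi).
(* An indicator at index [k] removes [k] from the general indices, so the induction hypothesis
   applies. *)
have IHB (B : set R) : measurable B ->
    (\int[P]_w ((\prod_(i | i != k) h i (X i w)) * \1_B (X k w))%:E =
     (\prod_(i | i != k) c i * fine (P (X k @^-1` B)))%:E)%E.
  move=> mB.
  pose h' i := if i == k then \1_B else h i.
  pose c' i := if i == k then fine (P (X k @^-1` B)) else c i.
  transitivity (\int[P]_w (\prod_i h' i (X i w))%:E)%E.
    apply: eq_integral => w _; rewrite [in RHS](bigD1 k)//= mulrC {1}/h' eqxx.
    by congr (_ * _)%:E; apply: eq_bigr => i /negbTE ik; rewrite /h' ik.
  rewrite (@IH h' c').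
  - rewrite (bigD1 k)//= mulrC {2}/c' eqxx; congr (_ * _)%:E.
    by apply: eq_bigr => i /negbTE ik; rewrite /c' ik.
  - move=> i ins; rewrite /h'; case: eqVneq => [_|ik]; first by exists B.
    by apply: hs; rewrite inE negb_or ik.
  - move=> i; rewrite /h'; case: eqVneq => // _; exact: measurable_indic.
  - by move=> i x; rewrite /h'; case: eqVneq.
  - move=> i; rewrite /h' /c'; case: eqVneq => // ->.
    by rewrite integral_indic_comp// fineK// preimage_fin_num.
pose Ck := \prod_(i | i != k) c i.
have Ck0 : 0 <= Ck.
  apply: prodr_ge0 => i _; rewrite -lee_fin -hc; apply: integral_ge0 => w _.
  by rewrite lee_fin.
transitivity (\int[P]_w ((\prod_(i | i != k) h i (X i w)) * h k (X k w))%:E)%E.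
  by apply: eq_integral => w _; rewrite (bigD1 k)//= mulrC.
(* Against indicators of [X k], the product of the other factors acts as the constant [Ck]; hence
   also against [h k]. *)
rewrite (@ge0_integral_mul_comp _ _ _ _ (X k) _ (cst Ck))//=.
- under eq_integral do rewrite EFinM.
  rewrite ge0_integralZl_EFin//.
  + by rewrite hc -EFinM [in RHS](bigD1 k)//= mulrC.
  + by move=> w _; rewrite lee_fin.
  + apply/measurable_EFinP.
    exact: (measurableT_comp (mh k) (@measurable_funPT _ _ _ _ (X k))).
- exact: measurable_prod_comp.
- by move=> w; apply: prodr_ge0.
- move=> B mB; rewrite IHB//.
  under eq_integral do rewrite EFinM.
  rewrite ge0_integralZl_EFin//.
  + by rewrite integral_indic_comp// EFinM fineK// preimage_fin_num.
  + apply/measurable_EFinP; apply: (measurableT_comp _ (@measurable_funPT _ _ _ _ (X k))).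
    exact: measurable_indic.
Qed.

End ProductFormula.

(** * Moments of sub-Gaussian variables *)

Lemma expR_sqr_half (R : realType) (u : R) : expR u = expR (u / 2) ^+ 2.
Proof. by rewrite -expRM_natl; congr expR; field. Qed.

(** With a = e^(u/2) and b = e^(-u/2), the excess over 2 is (a - b)^2, and a - b >= u/2 for u >=
    0. *)
Lemma expR_addN_ge (R : realType) (u : R) : 2 + u ^+ 2 / 4 <= expR u + expR (- u).
Proof.
wlog u0 : u / 0 <= u => [hw|].
  have [|u0] := leP 0 u; first exact: hw.
  by have := hw (- u); rewrite sqrrN opprK (addrC (expR (- u))); apply; lra.
have a1 := expR_ge1Dx (u / 2).
have b1 : expR (- (u / 2)) <= 1 by rewrite expR_le1; lra.
have ab : expR (u / 2) * expR (- (u / 2)) = 1 by rewrite -expRD subrr expR0.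
rewrite (expR_sqr_half u) (expR_sqr_half (- u)) mulNr.
set a := expR (u / 2) in a1 ab *; set b := expR (- (u / 2)) in b1 ab *.
have : (u / 2) ^+ 2 <= (a - b) ^+ 2 by rewrite ler_sqr ?nnegrE; lra.
rewrite sqrrB ab; lra.
Qed.

(** The left side is (a - b)^2 with a = e^(y/2), b = e^(-y/2), and a - b = a (1 - e^(-y)) <= a y for
    y >= 0. *)
Lemma expR_addN_le (R : realType) (y : R) :
  expR y + expR (- y) - 2 <= y ^+ 2 * (expR y + expR (- y)).
Proof.
wlog y0 : y / 0 <= y => [hw|].
  have [|y0] := leP 0 y; first exact: hw.
  by have := hw (- y); rewrite sqrrN opprK (addrC (expR (- y))); apply; lra.
have b1 : 1 - y <= expR (- y) by have := expR_ge1Dx (- y).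
have a0 := expR_gt0 (y / 2); have b0 := expR_gt0 (- (y / 2)).
have ab : expR (y / 2) * expR (- (y / 2)) = 1 by rewrite -expRD subrr expR0.
have bE := expR_sqr_half (- y); have aE := expR_sqr_half y.
rewrite mulNr in bE; rewrite bE in b1; rewrite aE bE.
set a := expR (y / 2) in a0 ab aE *; set b := expR (- (y / 2)) in b0 ab bE b1 *.
have h : a - b <= a * y.
  have -> : a - b = a * (1 - b ^+ 2) by rewrite expr2 mulrBr mulrA ab; ring.
  by rewrite ler_pM2l//; lra.
have b1' : b <= 1 by rewrite /b expR_le1; lra.
have a1' : 1 <= a by rewrite -ab ler_piMr// ltW.
have : (a - b) ^+ 2 <= (a * y) ^+ 2.
  by rewrite ler_sqr ?nnegrE ?subr_ge0 ?(le_trans b1')// mulr_ge0// ltW.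
rewrite sqrrB ab exprMn mulrDr => h2.
have : 0 <= y ^+ 2 * b ^+ 2 by rewrite mulr_ge0 ?sqr_ge0.
lra.
Qed.

(** Since e^x >= 1 + x, it suffices that (1 - x + x^2)(1 + x) = 1 + x^3 >= 1. *)
Lemma expRN_le_quad (R : realType) (x : R) : 0 <= x -> expR (- x) <= 1 - x + x ^+ 2.
Proof.
move=> x0; rewrite expRN -[leLHS]mul1r ler_pdivrMr ?expR_gt0//.
have x2 : 0 <= 1 - x + x ^+ 2 by have := sqr_ge0 (x - 1 / 2); rewrite sqrrB; lra.
apply: (le_trans _ (ler_wpM2l x2 (expR_ge1Dx x))).
have : 0 <= x ^+ 3 by rewrite exprn_ge0.
have -> : (1 - x + x ^+ 2) * (1 + x) = 1 + x ^+ 3 by ring.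
lra.
Qed.

(** For u >= 0, use e^u - 1 <= u e^u twice; negative [u] follows from the quadratic bound on
    e^(-x). *)
Lemma expR_le_quad (R : realType) (u : R) : expR u <= 1 + u + u ^+ 2 * expR `|u|.
Proof.
have [u0|u0] := leP 0 u.
  rewrite ger0_norm//.
  have h := expR_ge1Dx (- u).
  have h1 : expR u - 1 <= u * expR u.
    have -> : expR u - 1 = (1 - expR (- u)) * expR u.
      by rewrite mulrBl mul1r -expRD addNr expR0.
    by rewrite ler_wpM2r ?expR_ge0//; lra.
  have : u * (expR u - 1) <= u * (u * expR u) by rewrite ler_wpM2l.
  rewrite mulrA -expr2; lra.
have := @expRN_le_quad _ (- u); rewrite opprK sqrrN => /(_ _)/le_trans; apply; first lra.
rewrite lerD2l ler_peMr ?sqr_ge0//.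
by have := expR_ge1Dx `|u|; have := normr_ge0 u; lra.
Qed.

(* If [eta * W >= 1] the right-hand side exceeds 1; otherwise
   [eta * W <= y^2 (eta + eta * W) <= 2 y^2]. *)
Lemma expR_gauss_le_cosh (R : realType) (eta y : R)
    (W := (expR y + expR (- y)) / 2 - 1) :
  0 <= eta <= 1 -> expR (- (2 * y ^+ 2)) <= 1 - eta * W + eta ^+ 2 * W ^+ 2.
Proof.
move=> /andP[eta0 eta1].
have y2 := sqr_ge0 y.
have W0 : 0 <= W by have := expR_addN_ge y; rewrite /W; lra.
have WE : expR y + expR (- y) = 2 * (1 + W) by rewrite /W; field.
have Wle : W <= y ^+ 2 * (1 + W) by have := expR_addN_le y; rewrite WE; lra.
rewrite -exprMn; have [h|h] := leP 1 (eta * W).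
  have : expR (- (2 * y ^+ 2)) <= 1 by rewrite expR_le1; lra.
  have : 0 <= eta * W * (eta * W - 1) by rewrite mulr_ge0; lra.
  by rewrite mulrBr -expr2; lra.
apply: (le_trans _ (expRN_le_quad (mulr_ge0 eta0 W0))).
rewrite ler_expR lerN2.
have : eta * W <= y ^+ 2 * (eta + eta * W).
  by rewrite -[eta in eta + _]mulr1 -mulrDr mulrCA ler_wpM2l.
have : y ^+ 2 * (eta + eta * W) <= y ^+ 2 * 2 by rewrite ler_wpM2l//; lra.
lra.
Qed.

Lemma dyadic_bracket (R : realType) (x : R) : 1 <= x ->
  exists n, 2 ^+ n <= x < 2 ^+ n.+1.
Proof.
move=> x1.
have ex : exists n, x < 2 ^+ n.
  exists (Num.Def.archi_bound x); rewrite (lt_trans (archi_boundP _))//; first lra.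
  by rewrite -natrX ltr_nat ltn_expl.
case: (ex_minnP ex) => -[|n] xn nmin; first by rewrite expr0 ltNge x1 in xn.
exists n; rewrite xn andbT leNgt; apply/negP => /nmin.
by rewrite ltnn.
Qed.

(** * Exponential square moment from the tail bound *)

Section SubGaussianMoments.
Context {disp : measure_display} {T : measurableType disp} {R : realType}.
Variables (P : probability T R).

Lemma ge0_le_nneseries_term (f : nat -> \bar R) n :
  (forall k, 0 <= f k)%E -> (f n <= \sum_(k <oo) f k)%E.
Proof.
move=> f0; apply: (le_trans _ (nneseries_lim_ge n.+1 _)) => //.
by rewrite big_mkord (bigD1 ord_max)//= leeDl// sume_ge0.
Qed.

(* [exp (kappa X^2 / 2)] is bounded by the sum of [2^(n+1)] over the [n] with
   [2^n <= exp (kappa X^2 / 2)], an event of probability at most [beta / 4^n]. *)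
Lemma sub_gaussian_exp_sqr (beta kappa : R) (X : {RV P >-> R}) :
  0 < beta -> 0 < kappa -> sub_gaussian beta kappa X ->
  (\int[P]_w (expR (kappa / 2 * X w ^+ 2))%:E <= (4 * beta)%:E)%E.
Proof.
move=> beta0 kappa0 sgX.
pose v w := expR (kappa / 2 * X w ^+ 2).
pose A n := [set w | 2 ^+ n <= v w].
have mX : measurable_fun setT X by exact: measurable_funPT.
have mv : measurable_fun setT v.
  apply: measurableT_comp => //; apply: measurable_funM => //.
  exact: measurable_funX.
have mA n : measurable (A n).
  by rewrite -[A n]setTI; apply: measurable_fun_le.
have PA n : (P (A n) <= (beta * (4 ^+ n)^-1)%:E)%E.
  (* Chosen so that kappa t^2 / 2 = n ln 2; the tail bound at [t] is then beta / 4^n. *)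
  pose t := Num.sqrt (2 * n%:R * ln 2 / kappa).
  have t2 : t ^+ 2 = 2 * n%:R * ln 2 / kappa.
    have ln2 : 0 <= ln 2 :> R by rewrite ln_ge0//; lra.
    by rewrite sqr_sqrtr// divr_ge0// ?mulr_ge0// ltW.
  have AE : A n = [set w | t <= `|X w|].
    apply/seteqP; split=> w /=; rewrite /A /v /=.
      rewrite -[X in X ^+ n](@lnK _ 2) ?posrE// -expRM_natl ler_expR => h.
      rewrite -ler_sqr ?nnegrE ?sqrtr_ge0// t2 real_normK ?num_real//.
      by rewrite ler_pdivrMr//; lra.
    rewrite -[X in X ^+ n](@lnK _ 2) ?posrE// -expRM_natl ler_expR => h.
    move: h; rewrite -ler_sqr ?nnegrE ?sqrtr_ge0// t2 real_normK ?num_real//.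
    by rewrite ler_pdivrMr//; lra.
  rewrite AE; apply: (le_trans (sgX t (sqrtr_ge0 _))).
  rewrite lee_fin ler_pM2l// t2.
  have -> : - (kappa * (2 * n%:R * ln 2 / kappa)) = - (n%:R * (ln 2 + ln 2)).
    by field; rewrite gt_eqF.
  rewrite expRN expRM_natl expRD lnK ?posrE//.
  by rewrite (_ : 2 * 2 = 4)//; lra.
have v1 w : 1 <= v w.
  apply: (le_trans _ (expR_ge1Dx _)); rewrite lerDl.
  by rewrite mulr_ge0 ?sqr_ge0// divr_ge0// ltW.
pose f n w := ((2 ^+ n.+1)%:E * (\1_(A n) w)%:E)%E : \bar R.
have f0 n w : (0 <= f n w)%E by rewrite /f -EFinM lee_fin mulr_ge0// exprn_ge0.
have mf n : measurable_fun setT (f n).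
  apply/measurable_funeM; apply/measurable_EFinP; exact: measurable_indic.
apply: (@le_trans _ _ (\int[P]_w (\sum_(n <oo) f n w))%E).
  apply: ge0_le_integral => //.
  - exact/measurable_EFinP.
  - by apply: (ge0_emeasurable_sum (P := xpredT)) => // n w _ _; exact: f0.
  - move=> w _; rewrite -/(v w).
    have [n /andP[n1 n2]] := dyadic_bracket (v1 w).
    apply: (le_trans _ (ge0_le_nneseries_term n _)) => //.
    by rewrite /f indicE mem_set//= mule1 lee_fin ltW.
rewrite integral_nneseries//.
apply: lime_le.
  by apply: is_cvg_nneseries => n _ _; apply: integral_ge0 => w _; exact: f0.
apply: nearW => N.
apply: (@le_trans _ _ (\sum_(0 <= n < N) (2 * beta * (2 ^+ n)^-1)%:E)%E).
  apply: lee_sum => n _.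
  rewrite /f ge0_integralZl_EFin//; last first.
    by apply/measurable_EFinP; exact: measurable_indic.
  rewrite integral_indic// setIT.
  apply: (le_trans (lee_wpmul2l _ (PA n))); first by rewrite lee_fin.
  rewrite -EFinM lee_fin le_eqVlt; apply/orP; left; apply/eqP.
  have -> : 4 ^+ n = 2 ^+ n * 2 ^+ n :> R by rewrite -exprMn; congr (_ ^+ _); ring.
  by rewrite exprS; field; rewrite expf_neq0.
rewrite sumEFin lee_fin.
(* Weights 2^(n+1) against beta / 4^n leave a geometric series with total 4 beta. *)
have -> : \sum_(0 <= n < N) 2 * beta * (2 ^+ n)^-1 = 4 * beta * (1 - (2 ^+ N)^-1).
  elim: N => [|N IH]; first by rewrite big_nil expr0 invr1 subrr mulr0.
  rewrite big_nat_recr//= IH exprS; field; rewrite expf_neq0//.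
by rewrite ler_piMr ?mulr_ge0 ?ltW// gerBl.
Qed.

End SubGaussianMoments.

(** * Bounds on the moment generating function *)

Section MomentGeneratingFunction.
Context {disp : measure_display} {T : measurableType disp} {R : realType}.
Variables (P : probability T R) (beta kappa : R) (X : {RV P >-> R}).
Hypotheses (beta0 : 0 < beta) (kappa0 : 0 < kappa).
Hypothesis sgX : sub_gaussian beta kappa X.

(** The single source of integrability and moment bounds below: compare with the exponential of
    kappa X^2 / 2. *)
Lemma sub_gaussian_dominated (g : T -> R) (K : R) :
  0 <= K -> measurable_fun setT g ->
  (forall w, `|g w| <= K * expR (kappa / 2 * X w ^+ 2)) ->
  P.-integrable setT (EFin \o g) /\ `|\int[P]_w g w| <= K * (4 * beta).
Proof.
move=> K0 mg gK.
pose v w := expR (kappa / 2 * X w ^+ 2).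
have mv : measurable_fun setT v.
  apply: measurableT_comp => //; apply: measurable_funM => //.
  exact: measurable_funX.
have intv : P.-integrable setT (EFin \o v).
  apply/integrableP; split; first exact/measurable_EFinP.
  rewrite (le_lt_trans _ (ltry (4 * beta)))//.
  apply: (le_trans _ (sub_gaussian_exp_sqr beta0 kappa0 sgX)).
  rewrite le_eqVlt; apply/orP; left; apply/eqP.
  by apply: eq_integral => w _ /=; rewrite ger0_norm// expR_ge0.
have intKv : P.-integrable setT (EFin \o (fun w => K * v w)).
  rewrite (_ : _ \o _ = (fun w => K%:E * (EFin \o v) w)%E); last first.
    by apply/funext => w; rewrite /= EFinM.
  exact: integrableZl.
have intg : P.-integrable setT (EFin \o g).
  apply: (le_integrable _ _ _ intKv) => //; first exact/measurable_EFinP.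
  move=> w _ /=; rewrite lee_fin [leRHS]ger0_norm ?gK//.
  by rewrite mulr_ge0 // expR_ge0.
split => //.
apply: (le_trans (le_normr_Rintegral _ intg)) => //.
have intng : P.-integrable setT (EFin \o (fun w => `|g w|)) by exact: integrable_norm.
apply: (@le_trans _ _ (\int[P]_w (K * v w))); first exact: le_Rintegral.
rewrite RintegralZl// ler_wpM2l//.
have := sub_gaussian_exp_sqr beta0 kappa0 sgX.
rewrite -(fineK (integrable_fin_num _ intv))//.
Qed.

(** Completing the square in |x|. *)
Lemma expR_abs_le (u x : R) :
  expR (u * `|x|) <= expR (u ^+ 2 / (2 * kappa)) * expR (kappa / 2 * x ^+ 2).
Proof.
rewrite -expRD ler_expR -(real_normK (num_real x)).
have -> : u ^+ 2 / (2 * kappa) + kappa / 2 * `|x| ^+ 2 =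
    u * `|x| + (u - kappa * `|x|) ^+ 2 / (2 * kappa).
  by field; rewrite gt_eqF.
by rewrite lerDl divr_ge0 ?sqr_ge0// mulr_ge0// ltW.
Qed.

Let K1 := expR (1 / (2 * kappa)) * (4 * beta).

(** Bounds the integral of anything dominated by 2 exp(3 |X - mu|): e^(3 K1) pays for centring, e^(9
    / (2 kappa)) for completing the square, 4 beta for the exponential square moment. *)
Definition mgf_rate := 2 * expR (3 * K1) * expR (9 / (2 * kappa)) * (4 * beta).

Let mu := \int[P]_w X w.

Lemma sub_gaussian_mean : P.-integrable setT (EFin \o X) /\ `|mu| <= K1.
Proof.
apply: sub_gaussian_dominated => [||w]; first by rewrite expR_ge0.
  exact: measurable_funPT.
have := expR_abs_le 1 (X w); rewrite expr1n mul1r => /(le_trans _); apply.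
by have := expR_ge1Dx `|X w|; lra.
Qed.

Lemma centered_dominated (g : T -> R) :
  measurable_fun setT g ->
  (forall w, `|g w| <= 2 * expR (3 * `|X w - mu|)) ->
  P.-integrable setT (EFin \o g) /\ `|\int[P]_w g w| <= mgf_rate.
Proof.
move=> mg hg; apply: sub_gaussian_dominated => // w.
apply: (le_trans (hg w)); rewrite -2![X in _ <= X]mulrA ler_pM2l//.
have := expR_abs_le 3 (X w); rewrite (_ : 3 ^+ 2 = 9 :> R); last by ring.
move=> h; apply: (le_trans _ (ler_wpM2l (expR_ge0 (3 * K1)) h)).
rewrite -expRD ler_expR.
by have := ler_normB (X w) mu; have [_] := sub_gaussian_mean; lra.
Qed.

Let M t := \int[P]_w expR (t * X w).
Let Y w := X w - mu.
Let M0 t := \int[P]_w expR (t * Y w).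

Let mY : measurable_fun setT Y.
Proof. by apply: measurable_funB => //; exact: measurable_funPT. Qed.

Let mexpY t : measurable_fun setT (fun w => expR (t * Y w)).
Proof. by apply: measurableT_comp => //; apply: measurable_funM. Qed.

Lemma mgf_integrable t : P.-integrable setT (EFin \o (fun w => expR (t * X w))).
Proof.
apply: (sub_gaussian_dominated (K := expR (t ^+ 2 / (2 * kappa))) _ _ _).1 => [||w].
- by rewrite expR_ge0.
- by apply: measurableT_comp => //; apply: measurable_funM => //; exact: measurable_funPT.
- rewrite ger0_norm ?expR_ge0// -(real_normK (num_real t)).
  apply: (le_trans _ (expR_abs_le _ _)); rewrite ler_expR -normrM.
  exact: ler_norm.
Qed.

Let M0E t : M0 t = expR (- (t * mu)) * M t.
Proof.
rewrite /M -RintegralZl//; last exact: mgf_integrable.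
by apply: eq_Rintegral => w _; rewrite -expRD; congr expR; rewrite /Y; ring.
Qed.

(** The factors exp(t mu) and exp(-t mu) cancel, so the product does not see the mean. *)
Let M0M t : M0 t * M0 (- t) = M t * M (- t).
Proof.
rewrite !M0E mulrACA -expRD mulNr opprK addNr expR0 mul1r//.
Qed.

Let sqr_le y : y ^+ 2 <= 2 * expR `|y| :> R.
Proof.
have := expR_ge1Dxn 1 (normr_ge0 y); rewrite (real_normK (num_real y)).
rewrite (_ : 2`!%:R = 2)//; lra.
Qed.

Let integrable1 : P.-integrable setT (EFin \o (fun=> 1)).
Proof.
apply: (centered_dominated _ _).1 => // w; rewrite normr1.
by have := expR_ge1Dx (3 * `|X w - mu|); have := normr_ge0 (X w - mu); lra.
Qed.

Let integrableY : P.-integrable setT (EFin \o Y).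
Proof.
apply: (centered_dominated _ _).1 => // w; rewrite -/(Y w).
by have := expR_ge1Dx (3 * `|Y w|); have := normr_ge0 (Y w); lra.
Qed.

Let integrable_expY t : `|t| <= 2 ->
  P.-integrable setT (EFin \o (fun w => expR (t * Y w))).
Proof.
move=> t2; apply: (centered_dominated _ _).1 => // w; rewrite -/(Y w).
rewrite ger0_norm ?expR_ge0//.
have : expR (t * Y w) <= expR (3 * `|Y w|).
  rewrite ler_expR (le_trans (ler_norm _))// normrM ler_wpM2r//; lra.
by have := expR_ge0 (3 * `|Y w|); lra.
Qed.

(** The remainder of the quadratic bound on the exponential: Y^2 <= 2 e^|Y| and |t| <= 2 combine to
    2 e^(3 |Y|). *)
Let quad t : `|t| <= 2 ->
  let g w := Y w ^+ 2 * expR `|t * Y w| in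
  P.-integrable setT (EFin \o g) /\ `|\int[P]_w g w| <= mgf_rate.
Proof.
move=> t2 g; apply: centered_dominated => [|w].
  apply: measurable_funM; first exact: measurable_funX.
  apply: measurableT_comp => //; apply: measurableT_comp => //.
  exact: measurable_funM.
rewrite -/(Y w) ger0_norm; last first.
  by apply: mulr_ge0; [exact: sqr_ge0|exact: expR_ge0].
apply: (le_trans (ler_pM (sqr_ge0 _) (expR_ge0 _) (sqr_le _) (lexx _))).
rewrite -mulrA -expRD ler_pM2l// ler_expR normrM.
have : `|t| * `|Y w| <= 2 * `|Y w| by rewrite ler_wpM2r.
lra.
Qed.

Let integralY : \int[P]_w Y w = 0.
Proof.
rewrite RintegralB//; last 2 first.
  exact: sub_gaussian_mean.1.
  exact: finite_measure_integrable_cst.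
by rewrite Rintegral_cst//= probability_setT mulr1 subrr.
Qed.

Let integrable_add (f g : T -> R) : P.-integrable setT (EFin \o f) ->
  P.-integrable setT (EFin \o g) -> P.-integrable setT (EFin \o (fun w => f w + g w)).
Proof. by move=> intf intg; exact: (integrableD _ intf intg). Qed.

Let integrable_scale (a : R) (f : T -> R) : P.-integrable setT (EFin \o f) ->
  P.-integrable setT (EFin \o (fun w => a * f w)).
Proof. by move=> intf; exact: (integrableZl _ _ intf). Qed.

Let integral1 : \int[P]_w (1 : R) = 1.
Proof. by rewrite Rintegral_cst//= probability_setT mulr1. Qed.


(** The product is the generating function of the difference of two independent copies. Below, both
    centred factors are at least 1, so their product is at least their sum minus 1, and the unit
    variance enters the sum. Above, the linear term integrates to 0. *)
Lemma mgf_product_bounds t : variance P X = 1%:E -> `|t| <= 2 ->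
  1 + t ^+ 2 / 4 <= M t * M (- t) <= expR (2 * mgf_rate * t ^+ 2).
Proof.
move=> varX t2.
have tN2 : `|- t| <= 2 by rewrite normrN.
have muE : fine ('E_P[X])%E = mu by rewrite unlock.
have varY : \int[P]_w Y w ^+ 2 = 1.
  have := varX; rewrite /variance covariance.unlock muE expectation.unlock.
  move=> /(congr1 fine) /= <-; congr fine.
have intY2 : P.-integrable setT (EFin \o (fun w => Y w ^+ 2)).
  apply: (centered_dominated _ _).1 => [|w]; first exact: measurable_funX.
  rewrite -/(Y w) ger0_norm ?sqr_ge0//; apply: (le_trans (sqr_le _)).
  by rewrite ler_pM2l// ler_expR; have := normr_ge0 (Y w); lra.
have low u : `|u| <= 2 -> 1 <= M0 u.
  move=> u2; apply: (@le_trans _ _ (\int[P]_w (1 + u * Y w))).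
    rewrite RintegralD//; last exact: integrable_scale.
    by rewrite integral1 RintegralZl// integralY mulr0 addr0.
  apply: le_Rintegral => //; last by move=> w _; exact: expR_ge1Dx.
  - exact/integrable_add/integrable_scale.
  - exact: integrable_expY.
have upp u : `|u| <= 2 -> M0 u <= 1 + mgf_rate * u ^+ 2.
  move=> u2; have [intq leq] := quad u2.
  apply: (@le_trans _ _
      (\int[P]_w (1 + u * Y w + u ^+ 2 * (Y w ^+ 2 * expR `|u * Y w|)))).
    apply: le_Rintegral => //; first exact: integrable_expY.
      by apply: integrable_add; [apply: integrable_add => //|];
        exact: integrable_scale.
    by move=> w _; have := expR_le_quad (u * Y w); rewrite exprMn -mulrA.
  rewrite RintegralD//; last 2 first.
  - by apply: integrable_add => //; exact: integrable_scale.
  - exact: integrable_scale.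
  rewrite RintegralD//; last exact: integrable_scale.
  rewrite integral1 RintegralZl// integralY mulr0 addr0 lerD2l RintegralZl//.
  by rewrite mulrC ler_wpM2r ?sqr_ge0// (le_trans (ler_norm _)).
have two : 2 + t ^+ 2 / 4 <= M0 t + M0 (- t).
  have -> : 2 + t ^+ 2 / 4 = \int[P]_w (2 * 1 + t ^+ 2 / 4 * Y w ^+ 2).
    rewrite RintegralD//; [|exact: integrable_scale|exact: integrable_scale].
    by rewrite !RintegralZl// varY integral1 !mulr1.
  rewrite /M0 -RintegralD//; [|exact: integrable_expY|exact: integrable_expY].
  apply: le_Rintegral => //.
  - by apply: integrable_add; exact: integrable_scale.
  - by apply: integrable_add; exact: integrable_expY.
  - move=> w _; have := expR_addN_ge (t * Y w).
    by rewrite exprMn mulNr mulr1 mulrAC.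
rewrite -M0M; apply/andP; split.
  have := low _ t2; have := low _ tN2 => b1 a1.
  have : 0 <= (M0 t - 1) * (M0 (- t) - 1) by rewrite mulr_ge0 ?subr_ge0.
  rewrite mulrBr mulr1 mulrBl mul1r; lra.
have rate1 u : `|u| <= 2 -> M0 u <= expR (mgf_rate * u ^+ 2).
  by move=> /upp/le_trans; apply; exact: expR_ge1Dx.
have -> : 2 * mgf_rate * t ^+ 2 = mgf_rate * t ^+ 2 + mgf_rate * (- t) ^+ 2.
  by rewrite sqrrN; ring.
by rewrite expRD ler_pM// ?rate1// (le_trans ler01)// low.
Qed.

End MomentGeneratingFunction.

(** * Small ball and column bounds *)

Lemma markov_indicator disp (T : measurableType disp) (R : realType)
    (P : probability T R) (A : set T) (G : T -> R) (b : R) :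
  measurable A -> P.-integrable setT (EFin \o G) -> (forall w, 0 <= G w) ->
  (forall w, A w -> 1 <= G w) -> \int[P]_w G w <= b -> (P A <= b%:E)%E.
Proof.
move=> mA intG G0 AG Gb.
have mG := measurable_int _ intG.
rewrite -[P A]mul1e -integral_cst//.
apply: (@le_trans _ _ (\int[P]_w (G w)%:E)%E).
  apply: (@le_trans _ _ (\int[P]_(w in A) (G w)%:E)%E).
    apply: ge0_le_integral => //.
    exact: (measurable_funS _ (@subsetT _ A) mG).
  by apply: ge0_subset_integral => // w _; rewrite lee_fin.
by rewrite -(fineK (integrable_fin_num _ intG))// lee_fin.
Qed.

Lemma integrable_Rintegral_of_eq disp (T : measurableType disp) (R : realType)
    (P : {measure set T -> \bar R}) (f : T -> R) (c : R) :
  measurable_fun setT f -> (forall w, 0 <= f w) ->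
  (\int[P]_w (f w)%:E = c%:E)%E ->
  P.-integrable setT (EFin \o f) /\ \int[P]_w f w = c.
Proof.
move=> mf f0 fc; split; last by rewrite /Rintegral fc.
apply/integrableP; split; first exact/measurable_EFinP.
under eq_integral => w _ do rewrite /= ger0_norm//.
by rewrite fc ltry.
Qed.

Lemma Rintegral_lin_comb disp (T : measurableType disp) (R : realType)
    (P : {measure set T -> \bar R}) (K : eqType) (s : seq K) (a : K -> R)
    (f : K -> T -> R) :
  (forall k, P.-integrable setT (EFin \o f k)) ->
  P.-integrable setT (EFin \o (fun w => \sum_(k <- s) a k * f k w)) /\
  \int[P]_w (\sum_(k <- s) a k * f k w) = \sum_(k <- s) a k * \int[P]_w f k w.
Proof.
move=> intf; elim: s => [|k s [ints IH]].
  split; last first.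
    by rewrite big_nil /Rintegral integral0_eq// => w _; rewrite big_nil.
  rewrite (_ : _ \o _ = cst 0%E); first exact: integrable0.
  by apply/funext => w /=; rewrite big_nil.
have intk : P.-integrable setT (EFin \o (fun w => a k * f k w)).
  exact: (integrableZl _ _ (intf k)).
have sumE : (fun w => \sum_(l <- k :: s) a l * f l w) =
    (fun w => a k * f k w + \sum_(l <- s) a l * f l w).
  by apply/funext => w; rewrite big_cons.
rewrite sumE big_cons; split; first exact: (integrableD _ intk ints).
by rewrite RintegralD// IH RintegralZl.
Qed.

(** The index type lists the entries of 2n rows grouped into n pairs, the boolean selecting the row
    in a pair. *)
Lemma big_signed_rows (S : Type) (idx : S) (op : Monoid.com_law idx) (n d : nat)
    (F : ('I_n * bool) * 'I_d -> S) :
  \big[op/idx]_q F q =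
  \big[op/idx]_i \big[op/idx]_j op (F ((i, true), j)) (F ((i, false), j)).
Proof.
transitivity (\big[op/idx]_ib \big[op/idx]_j F (ib, j)).
  by rewrite pair_bigA; apply: eq_bigr => -[].
transitivity (\big[op/idx]_i \big[op/idx]_b \big[op/idx]_j F ((i, b), j)).
  by rewrite (pair_bigA _ (fun i b => \big[op/idx]_j F ((i, b), j)));
    apply: eq_bigr => -[].
by apply: eq_bigr => i _; rewrite big_bool -big_split.
Qed.

(** * Exponential moments of differences of paired rows *)

Section RowDifferences.
Context {disp : measure_display} {T : measurableType disp} {R : realType}.
Variables (P : probability T R) (n d : nat).
Variable X : ('I_n * bool) * 'I_d -> {RV P >-> R}.
Variable c : R -> R.
Hypothesis indX : mutually_independent X.
Hypothesis mgfX : forall q t, (\int[P]_w (expR (t * X q w))%:E = (c t)%:E)%E.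

Definition diff_matrix (w : T) : 'M[R]_(n, d) :=
  \matrix_(i, j) (X ((i, false), j) w - X ((i, true), j) w).

Let sg (b : bool) : R := (-1) ^+ b.

Lemma expR_diff_rows (z : 'cV[R]_d) (t : 'I_n -> R) w :
  \prod_i expR (t i * (diff_matrix w *m z) i 0) =
  \prod_q expR (t q.1.1 * z q.2 0 * sg q.1.2 * X q w).
Proof.
rewrite -!expR_sum; congr expR.
rewrite big_signed_rows; apply: eq_bigr => i _; rewrite mxE mulr_sumr.
by apply: eq_bigr => j _; rewrite mxE /sg /= expr0 expr1; ring.
Qed.

(** The moment generating function at [t] of one coordinate of [diff_matrix w *m z]. *)
Let phi (z : 'cV[R]_d) t := \prod_j (c (t * z j 0) * c (- (t * z j 0))).

Lemma integral_expR_diff_rows (z : 'cV[R]_d) (t : 'I_n -> R) :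
  P.-integrable setT
    (EFin \o (fun w => \prod_i expR (t i * (diff_matrix w *m z) i 0))) /\
  \int[P]_w (\prod_i expR (t i * (diff_matrix w *m z) i 0)) =
  \prod_i phi z (t i).
Proof.
rewrite (_ : (fun w => _) =
    (fun w => \prod_q expR (t q.1.1 * z q.2 0 * sg q.1.2 * X q w))).
  have mexp (a : R) : measurable_fun [set: R] (fun x => expR (a * x)).
    by apply: measurableT_comp => //; exact: measurable_funM.
  apply: integrable_Rintegral_of_eq.
  - apply: (@measurable_prod_comp _ _ _ _ _ X xpredT
      (fun q x => expR (t q.1.1 * z q.2 0 * sg q.1.2 * x))) => q.
    exact: mexp.
  - by move=> w; apply: prodr_ge0 => q _; exact: expR_ge0.
  rewrite (@independent_integral_prod _ _ _ _ _ X
    (fun q x => expR (t q.1.1 * z q.2 0 * sg q.1.2 * x))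
    (fun q => c (t q.1.1 * z q.2 0 * sg q.1.2))) //; last first.
  congr EFin.
  rewrite big_signed_rows; apply: eq_bigr => i _.
  by apply: eq_bigr => j _; rewrite /sg /= expr0 expr1 mulr1 mulrN1 mulrC.
by apply/funext => w; rewrite expR_diff_rows.
Qed.

(** Distributivity expands the product over all choices of one exponent per row; each term
    factorises, and distributivity folds the result back. *)
Lemma integral_exp_poly_diff_rows (K : finType) (a b : K -> R) (z : 'cV[R]_d) :
  let F w := \prod_i \sum_k a k * expR (b k * (diff_matrix w *m z) i 0) in
  P.-integrable setT (EFin \o F) /\
  \int[P]_w F w = (\sum_k a k * phi z (b k)) ^+ n.
Proof.
move=> F.
have FE : F = fun w => \sum_(g : {ffun 'I_n -> K}) (\prod_i a (g i)) *
    \prod_i expR (b (g i) * (diff_matrix w *m z) i 0).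
  apply/funext => w; rewrite /F bigA_distr_bigA.
  by apply: eq_bigr => g _; rewrite big_split.
have [intF intFE] := @Rintegral_lin_comb _ _ _ P {ffun 'I_n -> K} (index_enum _)
  (fun g => \prod_i a (g i))
  (fun g w => \prod_i expR (b (g i) * (diff_matrix w *m z) i 0))
  (fun g => (integral_expR_diff_rows z (fun i => b (g i))).1).
rewrite FE; split => //; apply: (etrans intFE).
rewrite -[in RHS](card_ord n) -prodr_const bigA_distr_bigA /=.
by apply: eq_bigr => g _; rewrite (integral_expR_diff_rows z _).2 big_split.
Qed.

End RowDifferences.

Lemma prod_1D_ge (R : realDomainType) (I : finType) (x : I -> R) :
  (forall i, 0 <= x i) -> 1 + \sum_i x i <= \prod_i (1 + x i).
Proof.
move=> x0; suff : 0 <= \sum_i x i /\ 1 + \sum_i x i <= \prod_i (1 + x i) by case.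
elim/big_rec2: _ => [|i s p _ [s0 sp]]; first by rewrite addr0.
split; first by rewrite addr_ge0.
apply: (@le_trans _ _ ((1 + x i) * (1 + s))); last by rewrite ler_wpM2l// addr_ge0.
by have := mulr_ge0 (x0 i) s0; rewrite mulrDl mulrDr; lra.
Qed.

Lemma sqnorm_ge0 (R : realType) (d : nat) (z : 'cV[R]_d) : 0 <= sqnorm z.
Proof. by apply: sumr_ge0 => i _; exact: sqr_ge0. Qed.

Lemma sqnormZ (R : realType) (d : nat) (a : R) (z : 'cV[R]_d) :
  sqnorm (a *: z) = a ^+ 2 * sqnorm z.
Proof. by rewrite mulr_sumr; apply: eq_bigr => i _; rewrite mxE exprMn. Qed.

Lemma sqnorm_coord_le (R : realType) (d : nat) (z : 'cV[R]_d) i : z i 0 ^+ 2 <= sqnorm z.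
Proof.
by rewrite /sqnorm (bigD1 i)//= lerDl; apply: sumr_ge0 => j _; exact: sqr_ge0.
Qed.

Lemma measurable_sqnorm_mul disp (T : measurableType disp) (R : realType) (n d : nat)
    (B : T -> 'M[R]_(n, d)) (z : 'cV[R]_d) :
  (forall i j, measurable_fun setT (fun w => B w i j)) ->
  measurable_fun setT (fun w => sqnorm (B w *m z)).
Proof.
move=> mB; apply: measurable_sum => i; apply: measurable_funX.
under eq_fun do rewrite mxE.
by apply: measurable_sum => j; exact: measurable_funM.
Qed.

Lemma measurable_ltr disp (T : measurableType disp) (R : realType) (f g : T -> R) :
  measurable_fun setT f -> measurable_fun setT g -> measurable [set w | f w < g w].
Proof.
move=> mf mg; rewrite (_ : [set w | _] = ~` [set w | g w <= f w]).
  by apply: measurableC; rewrite -[X in measurable X]setTI; exact: measurable_fun_le.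
by apply/seteqP; split=> w /=; rewrite ltNge => /negP.
Qed.

(** Equals eta / 8 for eta = 1 / (8 C2), where C2 = e^(8r) bounds [phi] on unit vectors for |t| <=
    2. *)
Definition small_ball_rate (R : realType) (r : R) : R := (64 * expR (8 * r))^-1.

(** * Lower tail of the squared norm of an image vector *)

Section SmallBall.
Context {disp : measure_display} {T : measurableType disp} {R : realType}.
Variables (P : probability T R) (n d : nat).
Variable X : ('I_n * bool) * 'I_d -> {RV P >-> R}.
Variables (c : R -> R) (r : R).
Hypothesis indX : mutually_independent X.
Hypothesis mgfX : forall q t, (\int[P]_w (expR (t * X q w))%:E = (c t)%:E)%E.
Hypothesis r0 : 0 <= r.
Hypothesis c_bounds : forall t, `|t| <= 2 ->
  1 + t ^+ 2 / 4 <= c t * c (- t) <= expR (2 * r * t ^+ 2).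

Let p := small_ball_rate r.
Let B := diff_matrix X.

Let mB i j : measurable_fun setT (fun w => B w i j).
Proof.
under eq_fun do rewrite mxE.
by apply: measurable_funB; exact: measurable_funPT.
Qed.

Let phi (z : 'cV[R]_d) t := \prod_j (c (t * z j 0) * c (- (t * z j 0))).

(** Coordinates of a unit vector are at most 1, so the entry bounds apply at each t z_j and multiply
    to bounds in |z|^2 = 1. *)
Let phi_bounds z t : sqnorm z = 1 -> `|t| <= 2 ->
  1 + t ^+ 2 / 4 <= phi z t <= expR (2 * r * t ^+ 2).
Proof.
move=> z1 t2.
have tz j : `|t * z j 0| <= 2.
  have zj : `|z j 0| <= 1.
    rewrite -(@ler_pXn2r _ 2) ?nnegrE// expr1n real_normK ?num_real//.
    by rewrite -z1 sqnorm_coord_le.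
  by rewrite normrM -[2]mulr1 ler_pM.
apply/andP; split.
  apply: (@le_trans _ _ (\prod_j (1 + (t * z j 0) ^+ 2 / 4))).
    apply: (le_trans _ (prod_1D_ge _)) => [|j]; last by rewrite divr_ge0 ?sqr_ge0.
    rewrite lerD2l -mulr_suml; under eq_bigr do rewrite exprMn.
    by rewrite -mulr_sumr -/(sqnorm z) z1 mulr1.
  apply: ler_prod => j _; apply/andP; split; last by case/andP: (c_bounds (tz j)).
  by rewrite addr_ge0// divr_ge0 ?sqr_ge0.
apply: (@le_trans _ _ (\prod_j expR (2 * r * (t * z j 0) ^+ 2))).
  apply: ler_prod => j _; case/andP: (c_bounds (tz j)) => h ->; rewrite andbT.
  by apply: (le_trans _ h); rewrite addr_ge0// divr_ge0 ?sqr_ge0.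
rewrite -expR_sum -mulr_sumr; under eq_bigr do rewrite exprMn.
by rewrite -mulr_sumr -/(sqnorm z) z1 mulr1.
Qed.

Let phiN z t : phi z (- t) = phi z t.
Proof. by apply: eq_bigr => j _; rewrite mulNr opprK mulrC. Qed.

Let C2 := expR (8 * r).
(** Small enough for the eta^2 terms of the polynomial to stay below half of the linear gain. *)
Let eta := (8 * C2)^-1.

Let C2_ge1 : 1 <= C2.
Proof. by apply: (le_trans _ (expR_ge1Dx _)); rewrite lerDl mulr_ge0. Qed.

Let C2_neq0 : C2 != 0.
Proof. by rewrite gt_eqF// expR_gt0. Qed.

Let etaC2 : eta * C2 = 1 / 8.
Proof. by rewrite /eta; field; exact: C2_neq0. Qed.

Let eta_bounds : 0 < eta <= 1 / 8.
Proof.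
have eta0 : 0 < eta by rewrite invr_gt0 mulr_gt0// expR_gt0.
by rewrite eta0 -etaC2 ler_peMr// ltW.
Qed.

Let pE : p = eta / 8.
Proof. by rewrite /p /small_ball_rate -/C2 /eta; field; exact: C2_neq0. Qed.

(* Coefficients of [1 - eta * W + eta^2 * W^2], with [W = cosh y - 1], in the
   exponentials [e^(b y)], [b = -2, ..., 2]. *)
Let a (k : 'I_5) : R := nth 0 [:: eta ^+ 2 / 4; - (eta / 2 + eta ^+ 2);
  1 + eta + eta ^+ 2 * 3 / 2; - (eta / 2 + eta ^+ 2); eta ^+ 2 / 4] k.
Let b (k : 'I_5) : R := nth 0 [:: - (2); - (1); 0; 1; 2] k.

Let gauss_le_poly y : expR (- (2 * y ^+ 2)) <= \sum_k a k * expR (b k * y).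
Proof.
have /andP[e0 e1] := eta_bounds.
apply: (le_trans (@expR_gauss_le_cosh _ eta y _)); first by apply/andP; split; lra.
rewrite !big_ord_recl big_ord0 /a /b /= mul0r expR0 !mulNr !mul1r.
have sq (x : R) : expR (2 * x) = expR x ^+ 2 by rewrite expRM_natl.
have sqN (x : R) : expR (- (2 * x)) = expR (- x) ^+ 2 by rewrite -mulrN sq.
rewrite sqN sq.
have ef : expR y * expR (- y) = 1 by rewrite -expRD subrr expR0.
set e := expR y in ef *; set f := expR (- y) in ef *.
(* The two polynomials in e and f differ by a multiple of e f - 1 = 0. *)
have -> : 1 - eta * ((e + f) / 2 - 1) + eta ^+ 2 * ((e + f) / 2 - 1) ^+ 2 =
    eta ^+ 2 / 4 * f ^+ 2 + (- ((eta / 2 + eta ^+ 2) * f) +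
     ((1 + eta + eta ^+ 2 * 3 / 2) * 1 + (- ((eta / 2 + eta ^+ 2) * e) +
     (eta ^+ 2 / 4 * e ^+ 2 + 0)))) + eta ^+ 2 / 2 * (e * f - 1) by field.
by rewrite ef subrr mulr0 addr0.
Qed.

(** The linear term gains at least eta / 4 because phi(1) >= 5/4; the quadratic one costs at most
    eta^2 C2 / 2 = eta / 16. What remains is at most 1 - eta / 8 = 1 - p. *)
Let poly_mean z : sqnorm z = 1 ->
  0 <= \sum_k a k * phi z (b k) <= expR (- p).
Proof.
move=> z1; have /andP[e0 e1] := eta_bounds.
have n2 : `|2 : R| <= 2 by rewrite ger0_norm.
have n1 : `|1 : R| <= 2 by rewrite ger0_norm//; lra.
have n0 : `|0 : R| <= 2 by rewrite normr0.
have /andP[u1 u2] := phi_bounds z1 n2; have /andP[v1 v2] := phi_bounds z1 n1.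
have phi0 : phi z 0 = 1.
  apply/eqP; rewrite eq_le; have := phi_bounds z1 n0.
  by rewrite expr0n /= !mulr0 mul0r addr0 expR0 => /andP[-> ->].
have uC : phi z 2 <= C2 by apply: (le_trans u2); rewrite ler_expR expr2; lra.
have vC : phi z 1 <= C2 by apply: (le_trans v2); rewrite ler_expR expr1n; have := r0; lra.
rewrite !big_ord_recl big_ord0 /a /b /= !phiN phi0.
have eu : eta * phi z 2 <= 1 / 8 by rewrite -etaC2 ler_wpM2l// ltW.
have ev : eta * phi z 1 <= 1 / 8 by rewrite -etaC2 ler_wpM2l// ltW.
have ev1 : eta * (5 / 4) <= eta * phi z 1 by rewrite ler_wpM2l//; lra.
have eu0 : 0 <= eta * phi z 2 by rewrite mulr_ge0//; lra.
have e2u : eta * (eta * phi z 2) <= eta * (1 / 8) by rewrite ler_wpM2l//; lra.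
have e2u0 : 0 <= eta * (eta * phi z 2) by rewrite mulr_ge0//; lra.
have e2v : eta * (eta * phi z 1) <= eta * (1 / 8) by rewrite ler_wpM2l//; lra.
have e2v1 : eta * (eta * (5 / 4)) <= eta * (eta * phi z 1) by rewrite ler_wpM2l//; lra.
have e2 : 0 <= eta * eta by rewrite mulr_ge0//; lra.
apply/andP; split; last first.
  apply: (le_trans _ (expR_ge1Dx _)); rewrite pE.
  rewrite !expr2; lra.
rewrite !expr2; lra.
Qed.

(** Chernoff bound: on the event exp(p n / 2 - 2 |B z|^2) >= 1, and each of the n rows contributes a
    factor e^(-p) to the expectation. *)
Lemma small_ball_normalized z : sqnorm z = 1 ->
  (P [set w | (sqnorm (B w *m z) <= p * n%:R / 4)%R] <=
   (expR (- (p * n%:R / 2)))%:E)%E.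
Proof.
move=> z1.
pose F w := \prod_i \sum_k a k * expR (b k * (B w *m z) i 0).
have [intF FE] := integral_exp_poly_diff_rows indX mgfX a b z.
pose C := expR (p * n%:R / 2).
have F0 w : 0 <= F w.
  by apply: prodr_ge0 => i _; exact: le_trans (expR_ge0 _) (gauss_le_poly _).
apply: (markov_indicator (G := fun w => C * F w)).
- rewrite -[X in measurable X]setTI; apply: measurable_fun_le => //.
  exact: measurable_sqnorm_mul.
- exact: (integrableZl _ _ intF).
- by move=> w; rewrite mulr_ge0// expR_ge0.
- move=> w /= hw.
  apply: (@le_trans _ _ (C * \prod_i expR (- (2 * (B w *m z) i 0 ^+ 2)))).
    rewrite -expR_sum -expRD; apply: (le_trans _ (expR_ge1Dx _)).
    by rewrite lerDl sumrN -mulr_sumr -/(sqnorm (B w *m z)); lra.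
  rewrite ler_wpM2l ?expR_ge0//; apply: ler_prod => i _.
  by rewrite expR_ge0 gauss_le_poly.
rewrite RintegralZl// FE.
have /andP[s0 s1] := poly_mean z1.
apply: (@le_trans _ _ (C * expR (- p) ^+ n)).
  by rewrite ler_wpM2l ?expR_ge0// lerXn2r// nnegrE expR_ge0.
by rewrite -expRM_natl -expRD ler_expR; lra.
Qed.

(** Homogeneity reduces to unit vectors; the strict inequality makes the event empty at z = 0. *)
Lemma small_ball z :
  (P [set w | (sqnorm (B w *m z) < p * n%:R / 4 * sqnorm z)%R] <=
   (expR (- (p * n%:R / 2)))%:E)%E.
Proof.
have := sqnorm_ge0 z; rewrite le_eqVlt => /orP[/eqP z0|z0].
  rewrite (_ : [set w | _] = set0) ?measure0 ?lee_fin ?expR_ge0//.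
  apply/seteqP; split=> w //=.
  by rewrite -z0 mulr0 ltNge sqnorm_ge0.
pose s := Num.sqrt (sqnorm z).
have s2 : s ^+ 2 = sqnorm z by rewrite sqr_sqrtr// ltW.
have s0 : s != 0 by rewrite sqrtr_eq0 -ltNge.
have z1 : sqnorm (s^-1 *: z) = 1.
  by rewrite sqnormZ -s2; field.
apply: (le_trans _ (small_ball_normalized z1)); apply: le_measure; rewrite ?inE.
- apply: measurable_ltr => //.
  exact: measurable_sqnorm_mul.
- rewrite -[X in measurable X]setTI; apply: measurable_fun_le => //.
  exact: measurable_sqnorm_mul.
move=> w /= /ltW h.
by rewrite -scalemxAr sqnormZ exprVn s2 mulrC ler_pdivrMr.
Qed.

End SmallBall.

(** Solves (kappa / 2) L = 1 + ln (1 + 4 beta): the logarithm offsets the exponential moment of an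
    entry and the 1 gives the decay. *)
Definition column_rate (R : realType) (beta kappa : R) : R :=
  (1 + ln (1 + 4 * beta)) / (kappa / 2).

(** Chernoff bound for the sum of squares of the 2n entries of column [j]; (x - y)^2 <= 2 (x^2 +
    y^2) passes to the differences. *)
Lemma column_tail disp (T : measurableType disp) (R : realType) (P : probability T R)
    (n d : nat) (X : ('I_n * bool) * 'I_d -> {RV P >-> R}) (beta kappa : R)
    (j : 'I_d) :
  0 < beta -> 0 < kappa -> mutually_independent X ->
  (forall q, sub_gaussian beta kappa (X q)) ->
  (P [set w | (4 * column_rate beta kappa * n%:R <
               sqnorm (col j (diff_matrix X w)))%R] <=
   (expR (- (2 * n%:R)))%:E)%E.
Proof.
move=> beta0 kappa0 indX sgX; set L := column_rate beta kappa.
(* The factor 1 outside column [j] lets the product formula range over all entries. *)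
pose h (q : ('I_n * bool) * 'I_d) (x : R) :=
  if q.2 == j then expR (kappa / 2 * x ^+ 2) else 1.
have mh q : measurable_fun [set: R] (h q).
  rewrite /h; case: (q.2 == j); last exact: measurable_cst.
  by apply: measurableT_comp => //; apply: measurable_funM => //; exact: measurable_funX.
have h0 q x : 0 <= h q x by rewrite /h; case: ifP => _ //; exact: expR_ge0.
have hint q : P.-integrable setT (EFin \o (fun w => h q (X q w))).
  rewrite /h; case: (q.2 == j); last exact: finite_measure_integrable_cst.
  apply/integrableP; split.
    apply/measurable_EFinP; apply: measurableT_comp => //.
    apply: measurable_funM => //; apply: measurable_funX; exact: measurable_funPT.
  rewrite (le_lt_trans _ (ltry (4 * beta)))//.
  apply: (le_trans _ (sub_gaussian_exp_sqr beta0 kappa0 (sgX q))).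
  rewrite le_eqVlt; apply/orP; left; apply/eqP.
  by apply: eq_integral => w _ /=; rewrite ger0_norm// expR_ge0.
pose c q := \int[P]_w h q (X q w).
have cE q : (\int[P]_w (h q (X q w))%:E = (c q)%:E)%E.
  exact/esym/fineK/(integrable_fin_num _ (hint q)).
have c0 q : 0 <= c q by apply: Rintegral_ge0 => w _; exact: h0.
have cj i b : c ((i, b), j) <= 1 + 4 * beta.
  rewrite -lee_fin -cE /h /= eqxx.
  apply: (le_trans (sub_gaussian_exp_sqr beta0 kappa0 (sgX _))).
  by rewrite lee_fin; lra.
have cNj q : q.2 != j -> c q = 1.
  move=> /negbTE qj; rewrite /c /h qj Rintegral_cst//= probability_setT mulr1//.
have [intF FE] := integrable_Rintegral_of_eq
  (measurable_prod_comp X xpredT mh)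
  (fun w => prodr_ge0 _ (fun q _ => h0 q (X q w)))
  (independent_integral_prod indX mh h0 cE).
have prodc : \prod_q c q <= (1 + 4 * beta) ^+ (2 * n).
  rewrite big_signed_rows exprM -[n in X in _ <= X]card_ord -prodr_const.
  apply: ler_prod => i _; rewrite (bigD1 j)//= big1 ?mulr1 => [|l lj]; last first.
    by rewrite !cNj// mulr1.
  by rewrite mulr_ge0//= expr2 ler_pM.
pose S w := \sum_i (X ((i, true), j) w ^+ 2 + X ((i, false), j) w ^+ 2).
have prodh w : \prod_q h q (X q w) = expR (kappa / 2 * S w).
  rewrite big_signed_rows mulr_sumr expR_sum; apply: eq_bigr => i _.
  rewrite (bigD1 j)//= big1 ?mulr1 => [|l /negbTE lj]; last by rewrite /h /= lj mulr1.
  by rewrite /h /= eqxx -expRD mulrDr.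
pose C := expR (- (kappa / 2 * (2 * L * n%:R))).
apply: (markov_indicator (G := fun w => C * \prod_q h q (X q w))).
- apply: measurable_ltr => //; apply: measurable_sum => i; apply: measurable_funX.
  under eq_fun do rewrite !mxE.
  by apply: measurable_funB; exact: measurable_funPT.
- exact: (integrableZl _ _ intF).
- by move=> w; rewrite mulr_ge0 ?expR_ge0// prodr_ge0.
- move=> w /= Lw; rewrite prodh -expRD; apply: (le_trans _ (expR_ge1Dx _)).
  have : sqnorm (col j (diff_matrix X w)) <= 2 * S w.
    rewrite mulr_sumr; apply: ler_sum => i _; rewrite !mxE.
    have := sqr_ge0 (X ((i, true), j) w + X ((i, false), j) w).
    by rewrite sqrrD sqrrB; lra.
  move=> SL; rewrite lerDl addrC -mulrBr mulr_ge0//; last lra.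
  by rewrite divr_ge0// ltW.
rewrite RintegralZl// FE.
have CE : C = expR (- (2 * n%:R)) * (1 + 4 * beta) ^- (2 * n).
  have b1 : 0 < 1 + 4 * beta by lra.
  rewrite -[in X in _ * X](@lnK _ (1 + 4 * beta)) ?posrE// -expRM_natl -expRN -expRD.
  congr expR; rewrite /L /column_rate natrM; field; rewrite gt_eqF//.
rewrite CE -mulrA ler_piMr ?expR_ge0//.
by rewrite mulrC ler_pdivrMr ?mul1r// exprn_gt0//; lra.
Qed.

(** * Reindexing, equal laws and the union bound *)

Lemma mutually_independent_comp disp (T : measurableType disp) (R : realType)
    (P : probability T R) (I J : finType) (X : I -> {RV P >-> R}) (f : J -> I) :
  injective f -> mutually_independent X ->
  mutually_independent (fun j => X (f j)).
Proof.
move=> injf indX S B mB.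
(* By injectivity this is [B j] at [f j]; off the image the empty intersection is the whole line. *)
pose B' i := \bigcap_(j in [set j | f j = i]) B j.
have B'f j : B' (f j) = B j.
  by apply/seteqP; split=> x; [apply|move=> Bx k /injf ->].
have mB' i : measurable (B' i) by apply: fin_bigcap_measurable.
have := indX (f @: S)%SET B' mB'.
rewrite big_imset /=; last by move=> ? ? _ _; exact: injf.
under eq_bigr do rewrite B'f.
move=> <-; congr (P _); apply/seteqP; split=> w /= Bw.
  by move=> i /= /imsetP[j jS ->]; rewrite B'f; exact: Bw.
by move=> j /= jS; rewrite -B'f; apply: Bw; apply: imset_f.
Qed.

Lemma identically_distributed_integral disp (T : measurableType disp) (R : realType)
    (P : probability T R) (I : finType) (X : I -> {RV P >-> R}) (f : R -> R) i j :
  identically_distributed X -> measurable_fun [set: R] f -> (forall x, 0 <= f x) ->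
  (\int[P]_w (f (X i w))%:E = \int[P]_w (f (X j w))%:E)%E.
Proof.
move=> idX mf f0.
have distE k : (\int[P]_w (f (X k w))%:E = \int[distribution P (X k)]_x (f x)%:E)%E.
  rewrite (@ge0_integral_distribution _ _ _ _ _ P (X k) (EFin \o f))//.
  exact/measurable_EFinP.
rewrite !distE; apply: eq_measure_integral => A mA _; exact: idX.
Qed.

Lemma union_bound disp (T : measurableType disp) (R : realType) (P : probability T R)
    (I : finType) (A : I -> set T) (x : R) :
  (forall i, measurable (A i)) -> (forall i, P (A i) <= x%:E)%E ->
  measurable (\bigcup_i A i) /\ (P (\bigcup_i A i) <= (#|I|%:R * x)%:E)%E.
Proof.
move=> mA Ax.
have -> : \bigcup_i A i = \big[setU/set0]_(i <- enum I) A i.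
  rewrite -bigcup_seq; apply: eq_bigcupl; split=> i //= _.
  by rewrite mem_enum.
rewrite cardE; elim: (enum I) => [|i s [ms IH]].
  by rewrite big_nil measure0 mul0r.
rewrite big_cons; split; first exact: measurableU.
apply: (le_trans (measureU2 _ _ _)) => //.
by rewrite /= -natr1 mulrDl mul1r addrC EFinD leeD.
Qed.

(** * The kernel of a random matrix *)

Lemma pair_row_subproof (N : nat) (ib : 'I_(N./2) * bool) : (ib.1.*2 + ib.2 < N)%N.
Proof. by case: ib => i b /=; have := ltn_ord i; case: b => /=; lia. Qed.

(** Rows 2i and 2i + 1 form pair [i]; an odd last row is left out. *)
Definition pair_row (N : nat) (ib : 'I_(N./2) * bool) : 'I_N :=
  Ordinal (pair_row_subproof ib).

Lemma pair_row_inj (N : nat) : injective (@pair_row N).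
Proof.
move=> [i b] [i' b'] /(congr1 val) /= ii.
have bb : b = b' by case: b b' ii => -[] //=; lia.
by congr (_, _) => //; apply: val_inj => /=; move: ii; rewrite bb; lia.
Qed.

(* Pairing the rows makes the entries symmetric, which removes the mean. *)
Lemma diff_matrix_kernel disp (T : measurableType disp) (R : realType)
    (P : probability T R) (N d : nat) (A : 'I_N -> 'I_d -> {RV P >-> R}) (w : T)
    (h : 'cV[R]_d) :
  random_matrix A w *m h = 0 ->
  diff_matrix (fun q => A (pair_row q.1) q.2) w *m h = 0.
Proof.
move=> /matrixP Ah; apply/matrixP => i k; rewrite ord1 !mxE.
transitivity ((random_matrix A w *m h) (pair_row (i, false)) 0 -
              (random_matrix A w *m h) (pair_row (i, true)) 0).
  by rewrite !mxE -sumrB; apply: eq_bigr => j _; rewrite !mxE mulrBl.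
by rewrite !Ah !mxE subrr.
Qed.

Lemma iid_pairs disp (T : measurableType disp) (R : realType) (P : probability T R)
    (beta kappa : R) (N d : nat) (A : 'I_N -> 'I_d -> {RV P >-> R})
    (X := fun q : ('I_(N./2) * bool) * 'I_d => A (pair_row q.1) q.2) :
  0 < beta -> 0 < kappa -> iid_sub_gaussian beta kappa A ->
  mutually_independent X /\
  exists2 c : R -> R,
    (forall q t, \int[P]_w (expR (t * X q w))%:E = (c t)%:E)%E &
    (forall q : ('I_(N./2) * bool) * 'I_d, forall t, `|t| <= 2 ->
      1 + t ^+ 2 / 4 <= c t * c (- t) <= expR (2 * mgf_rate beta kappa * t ^+ 2)).
Proof.
move=> beta0 kappa0 [indA idA sgA varA].
pose f (q : ('I_(N./2) * bool) * 'I_d) := (pair_row q.1, q.2).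
have finj : injective f.
  move=> [ib j] [ib' j'] fq; congr (_, _); last exact: (congr1 snd fq).
  by apply: pair_row_inj; exact: (congr1 fst fq).
split; first exact: (mutually_independent_comp finj indA).
have mexp t : measurable_fun [set: R] (fun x : R => expR (t * x)).
  by apply: measurableT_comp => //; exact: measurable_funM.
(* The common generating function is read off one entry [q0]; without entries every condition on [c]
   is vacuous. *)
case: (pickP (fun q : ('I_(N./2) * bool) * 'I_d => true)) => [q0 _|noq]; last first.
  by exists (fun=> 0) => q; have := noq q.
exists (fun t => \int[P]_w expR (t * X q0 w)) => [q t|q t t2].
  rewrite (identically_distributed_integral (f q) (f q0) idA (mexp t)); last first.
    by move=> x; exact: expR_ge0.
  have intq0 := mgf_integrable beta0 kappa0 (sgA (pair_row q0.1) q0.2) t.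
  exact/esym/fineK/(integrable_fin_num _ intq0).
exact: (mgf_product_bounds beta0 kappa0 (sgA _ _) (varA _ _) t2).
Qed.

(** The bad event is a union over (2d)^(M+1) sums of signed basis vectors and over d columns;
    outside it the deterministic kernel bound applies. *)
Lemma diff_matrix_l1_spread disp (T : measurableType disp) (R : realType)
    (P : probability T R) (n d M : nat) (X : ('I_n * bool) * 'I_d -> {RV P >-> R})
    (beta kappa : R) (c : R -> R)
    (p := small_ball_rate (mgf_rate beta kappa)) (L := column_rate beta kappa) :
  0 < beta -> 0 < kappa ->
  mutually_independent X -> (forall q, sub_gaussian beta kappa (X q)) ->
  (forall q t, \int[P]_w (expR (t * X q w))%:E = (c t)%:E)%E ->
  (forall t, `|t| <= 2 ->
      1 + t ^+ 2 / 4 <= c t * c (- t) <= expR (2 * mgf_rate beta kappa * t ^+ 2)) ->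
  exists E : set T, [/\ measurable E,
    (P (~` E) <= ((d * 2)%:R ^+ M.+1 * expR (- (p * n%:R / 2)) +
                  d%:R * expR (- (2 * n%:R)))%:E)%E
   & forall w, E w -> forall h, diff_matrix X w *m h = 0 ->
       p * n%:R / 4 * M%:R * sqnorm h <= 4 * L * n%:R * l1norm h ^+ 2].
Proof.
move=> beta0 kappa0 indX sgX mgfX cX.
have r0 : 0 <= mgf_rate beta kappa.
  by rewrite /mgf_rate !mulr_ge0 ?expR_ge0// ltW.
have p0 : 0 < p by rewrite invr_gt0 mulr_gt0// expR_gt0.
pose u (t : M.+1.-tuple ('I_d * bool)) := \sum_(j <- t) sgn_basis R j.
pose F t := [set w | sqnorm (diff_matrix X w *m u t) < p * n%:R / 4 * sqnorm (u t)].
pose G j := [set w | 4 * L * n%:R < sqnorm (col j (diff_matrix X w))].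
have mB i j : measurable_fun setT (fun w => diff_matrix X w i j).
  under eq_fun do rewrite mxE.
  by apply: measurable_funB; exact: measurable_funPT.
have [mF PF] := @union_bound _ _ _ P _ F _
  (fun t => measurable_ltr (measurable_sqnorm_mul (u t) mB) (measurable_cst _))
  (fun t => small_ball indX mgfX r0 cX (u t)).
have mcol j : measurable_fun setT (fun w => sqnorm (col j (diff_matrix X w))).
  apply: measurable_sum => i; apply: measurable_funX.
  under eq_fun do rewrite mxE.
  exact: mB.
have [mG PG] := @union_bound _ _ _ P _ G _
  (fun j => measurable_ltr (measurable_cst _) (mcol j))
  (fun j => column_tail j beta0 kappa0 indX sgX).
exists (~` (\bigcup_t F t `|` \bigcup_j G j)); split.
- exact/measurableC/measurableU.
- rewrite setCK; apply: (le_trans (measureU2 _ mF mG)).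
  rewrite EFinD; apply: leeD; last by rewrite card_ord in PG.
  by rewrite card_tuple card_prod card_ord card_bool natrX in PF.
- move=> w /= Ew h; apply: l1_spread_kernel.
  + by rewrite divr_ge0// mulr_ge0// ltW.
  + move=> t st; rewrite leNgt; apply/negP => bad; apply: Ew; left.
    by exists (Tuple (introT eqP st)).
  + by move=> j; rewrite leNgt; apply/negP => bad; apply: Ew; right; exists j.
Qed.

Lemma ln2_ge (R : realType) : 1 / 2 <= ln 2 :> R.
Proof.
rewrite -ler_expR lnK ?posrE//.
have := expR_ge1Dx (- (1 / 2) : R); rewrite expRN => h.
have e0 := expR_gt0 (1 / 2 : R).
have : (1 - 1 / 2) * expR (1 / 2) <= 1 :> R.
  by rewrite -ler_pdivlMr// [X in _ <= X]mul1r.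
lra.
Qed.

Lemma leq_half_double_succ (n : nat) : (n <= (2 * n./2).+1)%N.
Proof. by rewrite mul2n -{1}(odd_double_half n); case: (odd n). Qed.

Lemma random_l1_spread (R : realType) (beta kappa : R) (K : nat) :
  0 < beta -> 0 < kappa ->
  exists2 C : R, 0 < C &
  forall (N d k : nat) (eps : R)
    (disp : measure_display) (T : measurableType disp) (P : probability T R)
    (A : 'I_N -> 'I_d -> {RV P >-> R}),
    iid_sub_gaussian beta kappa A -> 0 < eps <= 1 -> (0 < d)%N ->
    (d = 1%N -> eps <= 2^-1) ->
    C * (k%:R * (ln d%:R + ln (1 / eps))) <= N%:R ->
    exists E : set T, [/\ measurable E, (P (~` E) <= (eps / 4)%:E)%E
      & forall w, E w -> l1_spread (K * k)%:R (random_matrix A w)].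
Proof.
move=> beta0 kappa0.
set p := small_ball_rate (mgf_rate beta kappa); set L := column_rate beta kappa.
have p0 : 0 < p by rewrite invr_gt0 mulr_gt0// expR_gt0.
have L0 : 0 < L.
  rewrite divr_gt0 ?divr_gt0// ltr_pwDl// ln_ge0//; lra.
(* With M = m0 k draws, p m0 >= 16 K L turns the kernel bound into spread K k. *)
pose m0 := Num.Def.archi_bound (16 * K%:R * L / p).
have m0P : 16 * K%:R * L <= p * m0%:R.
  rewrite [X in _ <= X]mulrC -ler_pdivrMr//; apply/ltW/archi_boundP.
  apply: divr_ge0; last exact: ltW.
  by apply: mulr_ge0; [rewrite mulr_ge0|exact: ltW].
(* Makes p n / 2 at least (2 m0 + 6) k l, with l = log d + log(1/eps): the part 2 (m0 + 1) k l
   covers the number of sums, the rest log(1/eps) + 3 log 2. *)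
have [q q0 pq] : exists2 q, 0 < q & p * q = 4 * m0%:R + 12.
  exists ((4 * m0%:R + 12) / p); last by field; rewrite gt_eqF.
  by rewrite divr_gt0// ltr_wpDl// mulr_ge0.
(* The 2 pays for pairing rows; 5 instead of 4 absorbs a possible unpaired row. *)
pose C := 2 * (5 + q).
exists C => [|N d k eps disp T P A iidA /andP[eps0 eps1] d0 d1 hN].
  by rewrite mulr_gt0//; lra.
case: k hN => [|k'] hN.
  exists setT; split => //; first by rewrite setCT measure0 lee_fin divr_ge0// ltW.
  by move=> w _ h _; rewrite muln0 mul0r sqr_ge0.
set k := k'.+1 in hN *.
set ld := ln d%:R in hN; set le := ln (1 / eps) in hN.
have ld0 : 0 <= ld by rewrite ln_ge0// ler1n.
have le0 : 0 <= le by rewrite ln_ge0// ler_pdivlMr// mul1r.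
(* For d >= 2 the term log d suffices; for d = 1 it vanishes and eps <= 1/2 takes over. *)
have l2 : ln 2 <= ld + le.
  have [dE|d2] := eqVneq d 1%N.
    have eps2 := d1 dE; have : ln 2 <= le; last by lra.
    rewrite ler_ln ?posrE ?divr_gt0// ler_pdivlMr//; lra.
  have : ln 2 <= ld; last by lra.
  by rewrite ler_ln ?posrE ?ltr0n// ler_nat ltn_neqAle eq_sym d2.
have ln2 := @ln2_ge R.
set l := ld + le in hN l2; have lE : l = ld + le by [].
have k1 : 1 <= k%:R :> R by rewrite ler1n.
have kl : l <= k%:R * l by rewrite ler_peMl//; lra.
pose n := N./2.
have kl0 : 0 <= k%:R * l by lra.
have n_ge : 4 * (k%:R * l) + q * (k%:R * l) <= n%:R.
  have : N%:R <= 2 * n%:R + 1 :> R.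
    by rewrite -natrM natr1 ler_nat leq_half_double_succ.
  by move: hN; rewrite /C; lra.
have pn_ge : (4 * m0%:R + 12) * (k%:R * l) <= p * n%:R.
  rewrite -pq -mulrA ler_pM2l//; lra.
have n4 : 4 * l <= n%:R.
  have : 0 <= q * (k%:R * l) by rewrite mulr_ge0// ltW.
  lra.
have n0 : 0 < n%:R :> R by lra.
have [indX [c mgfX cX]] := iid_pairs beta0 kappa0 iidA.
have n0' : (0 < N./2)%N by rewrite -(ltr0n R).
have [E [mE PE Espread]] := diff_matrix_l1_spread (m0 * k) beta0 kappa0 indX
  (fun q => let: And4 _ _ sgA _ := iidA in sgA _ _) mgfX
  (cX ((Ordinal n0', false), Ordinal d0)).
exists E; split => //.
  apply: (le_trans PE); rewrite lee_fin.
  (* An allowance of eps / 8 for the sums of basis vectors and eps / 8 for the columns. *)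
  have epsE : eps / 4 = expR (- le - 3 * ln 2) + expR (- le - 3 * ln 2).
    rewrite expRD -mulrN (@expRM_natl _ 3 (- ln 2)) !expRN /le !lnK ?posrE ?divr_gt0//.
    by field; rewrite gt_eqF.
  rewrite epsE; apply: lerD.
    rewrite -[(d * 2)%:R]lnK ?posrE ?ltr0n ?muln_gt0 ?d0//.
    rewrite natrM lnM ?posrE ?ltr0n// -expRM_natl -expRD ler_expR.
    rewrite -/ld -/p -/n.
    have M1 : (m0 * k).+1%:R <= (m0%:R + 1) * k%:R :> R.
      by rewrite -natr1 natrM mulrDl mul1r lerD2l.
    have : (m0 * k).+1%:R * (ld + ln 2) <= (m0%:R + 1) * k%:R * (2 * l).
      by apply: ler_pM => //; lra.
    lra.
  rewrite -[d%:R in X in X <= _]lnK ?posrE ?ltr0n// -expRD ler_expR -/ld -/n.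
  lra.
move=> w Ew h Ah.
have := Espread w Ew h (diff_matrix_kernel Ah).
rewrite -/p -/L -/n => spread.
have h0 := sqnorm_ge0 h.
have c4 : 0 < 4 * L * n%:R by do 2?[apply: mulr_gt0]; rewrite ?ltr0n.
rewrite -(ler_pM2l c4); apply: (le_trans _ spread).
rewrite -/(sqnorm h) mulrA ler_wpM2r// !natrM.
have : 16 * K%:R * L * (n%:R * k%:R) <= p * m0%:R * (n%:R * k%:R).
  by rewrite ler_wpM2r// mulr_ge0.
lra.
Qed.

(* C depends on beta and kappa only. The event of exact recovery is asserted to
   contain a measurable event of probability greater than 1 - eps.
   The hypothesis "d = 1 -> eps <= 1/2" only concerns the case d = 1, where
   log d = 0: there, without independence of Aroot and Anon, the claim is false
   for eps close to 1 (with one sample, Aroot and Anon may have disjoint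
   supports). *)
Theorem theorem4 (R : realType) (beta kappa : R) (hbeta : 0 < beta)
    (hkappa : 0 < kappa) :
  exists2 C : R, 0 < C &
  forall (m d s s' Nroot Nnon : nat) (e : rel 'I_m.+1)
    (xstar : 'I_m.+1 -> 'cV[R]_d) (eps : R)
    (disp : measure_display) (T : measurableType disp) (P : probability T R)
    (Aroot : 'I_Nroot -> 'I_d -> {RV P >-> R})
    (Anon : 'I_Nnon -> 'I_d -> {RV P >-> R}),
    is_tree e ->
    graph_sparse e s s' xstar ->
    iid_sub_gaussian beta kappa Aroot ->
    iid_sub_gaussian beta kappa Anon ->
    0 < eps ->
    (d = 1%N -> eps <= 2^-1) ->
    C * ((maxn s (degree e ord0 ^ 2 * s'))%:R * (ln d%:R + ln (1 / eps)))
      <= Nroot%:R ->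
    C * ((degree e ord0 ^ 2 * s')%:R * (ln d%:R + ln (1 / eps)))
      <= Nnon%:R ->
    exists E : set T,
      [/\ measurable E,
          ((1 - eps)%:E < P E)%E
        & forall w : T, E w ->
            tvbp_recovers e (random_matrix Aroot w) (random_matrix Anon w) xstar].
Proof.
have [C C0 spread] := random_l1_spread 1024 hbeta hkappa.
exists C => // m d s s' Nroot Nnon e xstar eps disp T P Aroot Anon tree sparse
  iidR iidN eps0 d1 hR hN.
(* For eps > 1 the bound 1 - eps is negative, so the empty event suffices. *)
have [eps1|eps1] := ltP 1 eps.
  exists set0; split => //.
  by rewrite measure0 lte_fin subr_lt0.
(* In dimension 0 every sum is empty and every matrix has the spread property. *)
have [d0|d0] := posnP d.
  exists setT; split => //.
    by rewrite probability_setT lte_fin ltrBlDr ltrDl.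
  move=> w _; apply: (l1_spread_tvbp_recovers tree sparse).
    by move=> h _; move: h; rewrite d0 => h; rewrite big_ord0 mulr0 sqr_ge0.
  by move=> h _; move: h; rewrite d0 => h; rewrite big_ord0 mulr0 sqr_ge0.
have eps01 : 0 < eps <= 1 by rewrite eps0.
have [E1 [mE1 PE1 spread1]] := spread _ _ _ _ _ _ _ _ iidR eps01 d0 d1 hR.
have [E2 [mE2 PE2 spread2]] := spread _ _ _ _ _ _ _ _ iidN eps01 d0 d1 hN.
exists (E1 `&` E2); split.
- exact: measurableI.
- have mE12 := measurableI _ _ mE1 mE2.
  (* Two failures of probability at most eps / 4 leave eps / 2 < eps, whence the strict
     inequality. *)
  have PC : (P (~` (E1 `&` E2)) <= (eps / 2)%:E)%E.
    rewrite setCI; apply: (le_trans (measureU2 _ (measurableC mE1) (measurableC mE2))).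
    apply: (le_trans (leeD PE1 PE2)); rewrite -EFinD lee_fin; lra.
  have PE : (P (E1 `&` E2) = 1 - P (~` (E1 `&` E2)))%E.
    by rewrite -{1}[E1 `&` E2]setCK probability_setC//; exact: measurableC.
  rewrite PE; apply: (@lt_le_trans _ _ (1 - (eps / 2)%:E)%E).
    by rewrite -EFinB lte_fin; lra.
  by rewrite leeB.
- move=> w [/spread1 s1 /spread2 s2].
  exact: (l1_spread_tvbp_recovers tree sparse s1 s2).
Qed.
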